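(* With the setting and notation of the context, consider the quadratic programming problem over $\beta\in\mathbb{R}^{\rho}$ $$\text{(QP)}\qquad \text{minimise } \beta^{T}A\beta\quad\text{subject to } QA\beta\leq\mathbf{b}\ \text{(componentwise)},$$ and the minimisation problem $$\text{(M)}\qquad \min\big\{\|v\|_{H}: v\in H,\ \lambda_i^{\ell,\theta}(v)\leq b_i^{\ell,\theta}\ \text{for all }\theta=1,\dots,\Theta,\ \ell=1,\dots,N^{\theta},\ i=1,\dots,\mathcal{P}^{\theta}\big\}.$$ If (QP) is feasible, then the unique minimiser of (M) is $$v(\mathbf{x})=\sum_{\theta=1}^{\Theta}\sum_{\ell=1}^{N^{\theta}}\sum_{i=1}^{\rho^{\ell,\theta}}\beta_i^{\ell,\theta}\,(\lambda_i^{\ell,\theta})^{\mathbf{y}}\Phi(\mathbf{x},\mathbf{y}),\qquad (\lambda_i^{\ell,\theta})^{\mathbf{y}}\Phi(\mathbf{x},\mathbf{y})=\nabla_{\mathbf{y}}\Phi(\mathbf{x},\mathbf{y})\big|_{\mathbf{y}=\mathbf{x}^{\ell,\theta}}\cdot\mathbf{f}_{p_i^{\ell,\theta}}(\mathbf{x}^{\ell,\theta}),$$ where the coefficient vector $\beta=(\beta_i^{\ell,\theta})$ is the solution (minimiser) of (QP).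
   Context: **Switched system.** $\Omega\subset\mathbb{R}^{d}$ is a bounded domain with Lipschitz boundary, $I=\{1,\dots,k_0\}$ is a finite index set. For each $i\in I$, $C_i\subset\Omega$ is a set with $\mathbf{0}\in C_i$ and $C_i=\overline{(C_i)^{\circ}}$ (closure and interior relative to $\Omega$), the sets $C_i$ cover $\Omega$, and $\mathbf{f}_i:C_i\to\mathbb{R}^d$ is locally Lipschitz continuous with $\mathbf{f}_i(\mathbf{0})=\mathbf{0}$. The switched system is $\dot{\mathbf{x}}=\mathbf{f}_i(\mathbf{x})$, where the active index $i$ may be any index with $\mathbf{x}\in C_i$ and may change in time; it is also assumed that there are no sliding modes (finitely many switches in finite time). **Partition.** For $\emptyset\neq P\subseteq I$ let $\Omega^{P}=\big(\bigcap_{i\in P}C_i\big)\cap\big(\bigcap_{j\in I\setminus P}C_j^{c}\big)$, complements being taken in $\Omega$. Let $P^{1},\dots,P^{\Theta}$ enumerate the sets $P$ with $\Omega^{P}\neq\emptyset$, and let $\mathcal{P}^{\theta}=|P^{\theta}|$. **Kernel and Hilbert space.** Wendland functions: $\phi_{\ell,0}(r)=(1-r)_+^{\ell}$ and $\phi_{\ell,k+1}(r)=\int_r^{1}t\,\phi_{\ell,k}(t)\,dt$ for $0\le r\le1$, extended by $0$ for $r>1$. Fix $c>0$ and $k\in\mathbb{N}$, put $\ell=\lfloor d/2\rfloor+k+1$ and $\Psi_0(r)=\phi_{\ell,k}(cr)$. Define $\Psi_i(r)=\frac1r\Psi_{i-1}'(r)$ for $r>0$, $i=1,2$; $k$ is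 assumed large enough that $\lim_{r\to0}\Psi_i(r)$ exists for $i=1,2$. Let $\Phi(\mathbf{x},\mathbf{y})=\Psi_0(\|\mathbf{x}-\mathbf{y}\|_2)$ on $\Omega\times\Omega$ and let $H$ be the reproducing kernel Hilbert space of functions $\Omega\to\mathbb{R}$ with reproducing kernel $\Phi$. **Collocation points and right-hand sides.** For each $\theta$, finitely many pairwise distinct nonzero points $\mathbf{x}^{1,\theta},\dots,\mathbf{x}^{N^\theta,\theta}\in\Omega^{P^\theta}$ are fixed. For each $p\in I$ a function $b_p:C_p\to\mathbb{R}$ is given with $b_p(\mathbf{0})=0$ and $b_p(\mathbf{x})<0$ for $\mathbf{x}\neq\mathbf{0}$. **Selection of basis.** For each $\theta,\ell$ (here $\ell\in\{1,\dots,N^\theta\}$ indexes points) let $\rho^{\ell,\theta}$ be the rank of the family $(\mathbf{f}_p(\mathbf{x}^{\ell,\theta}))_{p\in P^\theta}$, and fix an ordering $(p_1^{\ell,\theta},\dots,p_{\mathcal{P}^\theta}^{\ell,\theta})$ of the elements of $P^\theta$ such that the vectors $\mathbf{f}_{p_i^{\ell,\theta}}(\mathbf{x}^{\ell,\theta})$, $i=1,\dots,\rho^{\ell,\theta}$, form a basis of the span of that family. For $i=1,\dots,\mathcal{P}^\theta$ define the functional $\lambda_i^{\ell,\theta}\in H^*$ by $\lambda_i^{\ell,\theta}(v)=\nabla v(\mathbf{x}^{\ell,\theta})\cdot\mathbf{f}_{p_i^{\ell,\theta}}(\mathbf{x}^{\ell,\theta})$, and put $b_i^{\ell,\theta}=b_{p_i^{\ell,\theta}}(\mathbf{x}^{\ell,\theta})$.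 Let $\alpha_{\sigma,i}^{\ell,\theta}\in\mathbb{R}$ be the coefficients (from expressing $\mathbf{f}_{p_\sigma^{\ell,\theta}}(\mathbf{x}^{\ell,\theta})$ in the chosen basis) with $\lambda_\sigma^{\ell,\theta}=\sum_{i=1}^{\rho^{\ell,\theta}}\alpha_{\sigma,i}^{\ell,\theta}\lambda_i^{\ell,\theta}$, $\sigma=1,\dots,\mathcal{P}^\theta$. Put $\rho=\sum_{\theta=1}^{\Theta}\sum_{\ell=1}^{N^\theta}\rho^{\ell,\theta}$ and $\mathcal{P}=\sum_{\theta=1}^{\Theta}\sum_{\ell=1}^{N^\theta}\mathcal{P}^\theta$. **Matrices.** $A\in\mathbb{R}^{\rho\times\rho}$ is the symmetric matrix indexed by triples $(\theta,\ell,i)$, $1\le\theta\le\Theta$, $1\le\ell\le N^\theta$, $1\le i\le\rho^{\ell,\theta}$, with entries $$a_{i,j}^{\theta,\eta;\ell,m}=(\lambda_j^{m,\eta})^{\mathbf{x}}(\lambda_i^{\ell,\theta})^{\mathbf{y}}\Phi(\mathbf{x},\mathbf{y})=\langle(\lambda_j^{m,\eta})^{\mathbf{y}}\Phi(\cdot,\mathbf{y}),(\lambda_i^{\ell,\theta})^{\mathbf{x}}\Phi(\cdot,\mathbf{x})\rangle_H,$$ where a superscript $\mathbf{x}$ or $\mathbf{y}$ on a functional denotes application with respect to that variable. $Q=\begin{pmatrix}I\\ \tilde Q\end{pmatrix}\in\mathbb{R}^{\mathcal{P}\times\rho}$, where $I$ here is the $\rho\times\rho$ identity and $\tilde Q$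 is block diagonal with blocks $\tilde Q^{\ell,\theta}$ (ordered by $\theta$, then $\ell$) of size $(\mathcal{P}^\theta-\rho^{\ell,\theta})\times\rho^{\ell,\theta}$ and entries $q_{s,i}^{\ell,\theta}=\alpha_{s+\rho^{\ell,\theta},i}^{\ell,\theta}$. The vector $\mathbf{b}=(\mathbf{c},\tilde{\mathbf{c}})\in\mathbb{R}^{\mathcal{P}}$ is ordered compatibly with $Q$: $\mathbf{c}$ has entries $b_i^{\ell,\theta}$, $1\le i\le\rho^{\ell,\theta}$, and $\tilde{\mathbf{c}}$ has entries $b_{s+\rho^{\ell,\theta}}^{\ell,\theta}$, $1\le s\le\mathcal{P}^\theta-\rho^{\ell,\theta}$. Vectors $\beta\in\mathbb{R}^\rho$ are indexed by the same triples $(\theta,\ell,i)$ as $A$. *)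

(* Defs.v *)
From HB Require Import structures.
From mathcomp Require Import all_boot all_order all_algebra.
From mathcomp Require Import all_classical all_reals all_analysis.
Set Implicit Arguments.
Unset Strict Implicit.
Unset Printing Implicit Defensive.
Import Order.TTheory GRing.Theory Num.Theory.
Import numFieldNormedType.Exports.
Local Open Scope classical_set_scope.
Local Open Scope ring_scope.

(* R^d is 'rV[R]_d. The library norm on 'rV[R]_d is the sup norm: it induces
   the same open, closed, bounded and locally Lipschitz notions, but the radial
   kernel needs the Euclidean norm. *)
Section Euclidean.
Variables (R : realType) (d : nat).
Implicit Types (u v : 'rV[R]_d).

Definition dotv u v : R := \sum_j u ord0 j * v ord0 j.

Definition enorm u : R := Num.sqrt (dotv u u).

Definition grad (v : 'rV[R]_d -> R) (x : 'rV[R]_d) : 'rV[R]_d :=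
  \row_j 'D_(delta_mx ord0 j) v x.

End Euclidean.

Section Domain.
Variables (R : realType) (d : nat).
Implicit Types (Omega : set 'rV[R]_d).

(* Near each boundary point x, after a rigid motion (orthogonal matrix O,
   choice of a coordinate axis j), Omega is the strict epigraph of a Lipschitz
   function of the remaining d - 1 coordinates. *)
Definition lipschitz_boundary Omega : Prop :=
  forall x : 'rV[R]_d, (closure Omega `\` Omega°) x ->
  exists (e : R) (O : 'M[R]_d) (j : 'I_d) (g : 'rV[R]_d.-1 -> R) (L : R),
    [/\ 0 < e, O *m O^T = 1%:M,
        forall a b, `|g a - g b| <= L * enorm (a - b) &
        forall y : 'rV[R]_d, enorm (y - x) < e ->
          (Omega y <-> g (col' j (y *m O)) < (y *m O) ord0 j)].

Definition lipschitz_domain Omega : Prop :=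
  [/\ Omega !=set0, open Omega, connected Omega, bounded_set Omega &
      lipschitz_boundary Omega].

Definition rel_interior Omega (A : set 'rV[R]_d) : set 'rV[R]_d :=
  [set x | Omega x /\ within Omega (nbhs x) A].

Definition rel_closure Omega (A : set 'rV[R]_d) : set 'rV[R]_d :=
  Omega `&` closure A.

End Domain.

Section SwitchedSystem.
Variables (R : realType) (d k0 : nat).
Variables (Omega : set 'rV[R]_d) (C : 'I_k0 -> set 'rV[R]_d).
Variable f : 'I_k0 -> 'rV[R]_d -> 'rV[R]_d.

(* f i is a map on C i, represented by a total function whose values outside
   C i are irrelevant. *)
Definition switched_system : Prop :=
  [/\ forall i, [/\ C i `<=` Omega, C i 0 &
                    C i = rel_closure Omega (rel_interior Omega (C i))],
      Omega `<=` \bigcup_i C i,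
      forall i x, C i x ->
        exists2 V, nbhs x V & [lipschitz (f i) y | y in V `&` C i] &
      forall i, f i 0 = 0].

(* Caratheodory solution of x' = f_s(x) on [0, T] with switching signal s. *)
Definition switched_solution (T : R) (x : R -> 'rV[R]_d) (s : R -> 'I_k0) :
    Prop :=
  forall t, t \in `[0, T] ->
    C (s t) (x t) /\
    forall j, let g r := f (s r) (x r) ord0 j in
      lebesgue_measure.-integrable `[0, t] (EFin \o g) /\
      x t ord0 j = x 0 ord0 j + \int[lebesgue_measure]_(r in `[0, t]) g r.

(* ts lists all the switching times of s in [0, T]. *)
Definition finitely_many_switches (T : R) (s : R -> 'I_k0) : Prop :=
  exists ts : seq R, forall a b, 0 <= a -> a <= b -> b <= T ->
    (forall t, t \in ts -> ~~ (a <= t <= b)) -> s a = s b.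

(* The active index is not determined by the state on overlaps of the C i (at
   the equilibrium every signal is possible), so the absence of sliding modes is
   a property of the class traj of trajectories admitted by the system. *)
Definition no_sliding_modes
    (traj : R -> (R -> 'rV[R]_d) -> (R -> 'I_k0) -> Prop) : Prop :=
  forall T x s, traj T x s ->
    switched_solution T x s /\ finitely_many_switches T s.

Definition part (P : {set 'I_k0}) : set 'rV[R]_d :=
  [set x | Omega x /\ (forall i, i \in P -> C i x) /\
           (forall j, j \notin P -> ~ C j x)].

End SwitchedSystem.

Section Wendland.
Variable R : realType.

(* Only used for arguments r >= 0. *)
Fixpoint wendland (l k : nat) (r : R) : R :=
  if k is k'.+1 then
    if r <= 1 then \int[lebesgue_measure]_(t in `[r, 1]) (t * wendland l k' t)
    else 0
  else Num.max 0 (1 - r) ^+ l.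

(* Psi d k c i is the function Psi_i; for i > 0 it is meaningful for r > 0. *)
Fixpoint Psi (d k : nat) (c : R) (i : nat) (r : R) : R :=
  if i is i'.+1 then r^-1 * derive1 (Psi d k c i') r
  else wendland (d./2 + k + 1) k (c * r).

Definition Phi (d k : nat) (c : R) (x y : 'rV[R]_d) : R :=
  Psi d k c 0 (enorm (x - y)).

End Wendland.

Section RKHS.
Variables (R : realType) (d : nat) (Omega : set 'rV[R]_d).
Variables (K : 'rV[R]_d -> 'rV[R]_d -> R).
Variables (H : set ('rV[R]_d -> R)).
Variable ip : ('rV[R]_d -> R) -> ('rV[R]_d -> R) -> R.

Definition hnorm (v : 'rV[R]_d -> R) : R := Num.sqrt (ip v v).

(* A function Omega -> R is encoded by its extension by 0 to R^d, so that
   equality of encodings is equality of functions on Omega. As Omega is open,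
   gradients at points of Omega do not depend on the extension. *)
Definition restr0 (v : 'rV[R]_d -> R) : 'rV[R]_d -> R :=
  patch (fun=> 0) Omega v.

Record is_RKHS : Prop := {
  rkhs_on : forall v, H v -> restr0 v = v;
  rkhs_0 : H (fun=> 0);
  rkhs_lin : forall a u v, H u -> H v -> H (fun x => a * u x + v x);
  rkhs_ip_sym : forall u v, H u -> H v -> ip u v = ip v u;
  rkhs_ip_lin : forall a u v w, H u -> H v -> H w ->
    ip (fun x => a * u x + v x) w = a * ip u w + ip v w;
  rkhs_ip_ge0 : forall v, H v -> 0 <= ip v v;
  rkhs_ip_eq0 : forall v, H v -> ip v v = 0 -> v = (fun=> 0);
  rkhs_complete : forall u : nat -> 'rV[R]_d -> R, (forall n, H (u n)) ->
    (forall e, 0 < e -> exists N, forall m n, (N <= m)%N -> (N <= n)%N ->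
       hnorm (fun x => u m x - u n x) < e) ->
    exists2 v, H v & (fun n => hnorm (fun x => u n x - v x)) @ \oo --> (0 : R);
  rkhs_kernel : forall y, Omega y -> H (restr0 (K ^~ y));
  rkhs_reproducing : forall v y, H v -> Omega y ->
    v y = ip v (restr0 (K ^~ y))
}.

End RKHS.

(* nbparts is Theta, Pset th is P^th, npts th is N^th and pts th l is x^{l,th};
   ord th l i and coef th l s i are p_{i+1}^{l,th} and alpha_{s+1,i+1}^{l,th}:
   the indices i, s are 0-based, and values beyond the relevant range are never
   used. *)
Record collocation (R : realType) (d k0 : nat) := Collocation {
  nbparts : nat;
  Pset : 'I_nbparts -> {set 'I_k0};
  npts : 'I_nbparts -> nat;
  pts : forall th, 'I_(npts th) -> 'rV[R]_d;
  ord : forall th, 'I_(npts th) -> nat -> 'I_k0;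
  coef : forall th, 'I_(npts th) -> nat -> nat -> R
}.

Section Collocation.
Variables (R : realType) (d k0 : nat).
Variables (f : 'I_k0 -> 'rV[R]_d -> 'rV[R]_d) (b : 'I_k0 -> 'rV[R]_d -> R).
Variable D : collocation R d k0.

(* The pairs (th, l). *)
Definition node : finType := {th : 'I_(nbparts D) & 'I_(npts th)}.

Implicit Types t : node.

Definition nset t : {set 'I_k0} := Pset (tag t).
Definition npt t : 'rV[R]_d := pts (tagged t).
Definition nord t : nat -> 'I_k0 := ord (tagged t).
Definition ncoef t : nat -> nat -> R := coef (tagged t).

(* The vectors f_p(x^{l,th}) for p in P^th, and f_{p_{i+1}^{l,th}}(x^{l,th}). *)
Definition family t : seq 'rV[R]_d := [seq f q (npt t) | q in nset t].
Definition fvec t (i : nat) : 'rV[R]_d := f (nord t i) (npt t).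

Definition rank t : nat := \dim <<family t>>.

Definition enumerates_parts (Omega : set 'rV[R]_d)
    (C : 'I_k0 -> set 'rV[R]_d) : Prop :=
  injective (@Pset R d k0 D) /\
  forall P : {set 'I_k0},
    (exists th : 'I_(nbparts D), Pset th = P) <->
    (P != finset.set0 /\ part Omega C P !=set0).

Definition collocation_points (Omega : set 'rV[R]_d)
    (C : 'I_k0 -> set 'rV[R]_d) : Prop :=
  [/\ forall th : 'I_(nbparts D), injective (@pts R d k0 D th),
      forall t, npt t != 0 &
      forall t, part Omega C (nset t) (npt t)].

Definition basis_selection : Prop :=
  forall t,
    [/\ perm_eq [seq nord t i | i <- iota 0 #|nset t|] (enum (nset t)),
        basis_of <<family t>> [seq fvec t i | i <- iota 0 (rank t)] &
        forall s, (s < #|nset t|)%N ->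
          fvec t s = \sum_(i < rank t) ncoef t s i *: fvec t i].

(* The functional lambda_{i+1}^{l,th} and the number b_{i+1}^{l,th}. *)
Definition lam t (i : nat) (v : 'rV[R]_d -> R) : R :=
  dotv (grad v (npt t)) (fvec t i).
Definition bval t (i : nat) : R := b (nord t i) (npt t).

(* basis_index is the set of triples (th, l, i), 1 <= i <= rho^{l,th}, and
   dep_index that of the triples (th, l, s), 1 <= s <= |P^th| - rho^{l,th}; the
   cardinal of the former is rho, and their sum is the total number of
   constraints. Matrix rows and columns follow the enumerations of these finite
   types, which are lexicographic. *)
Definition basis_index : finType := {t : node & 'I_(rank t)}.
Definition dep_index : finType := {t : node & 'I_(#|nset t| - rank t)}.

Variable K : 'rV[R]_d -> 'rV[R]_d -> R.

(* The function x |-> (lambda_i)^y K(x, y), for a triple i. *)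
Definition lamK (i : basis_index) (x : 'rV[R]_d) : R :=
  lam (tag i) (tagged i) (fun y => K x y).

Definition matA : 'M[R]_#|basis_index| :=
  \matrix_(r, s) let j : basis_index := enum_val s in
    lam (tag j) (tagged j) (lamK (enum_val r)).

Definition matQtilde : 'M[R]_(#|dep_index|, #|basis_index|) :=
  \matrix_(r, s) let u : dep_index := enum_val r in let i : basis_index := enum_val s in
    if tag u == tag i then ncoef (tag u) (tagged u + rank (tag u)) (tagged i)
    else 0.

Definition matQ : 'M[R]_(#|basis_index| + #|dep_index|, #|basis_index|) :=
  col_mx 1%:M matQtilde.

Definition vecb : 'cV[R]_(#|basis_index| + #|dep_index|) :=
  col_mx (\col_r let i : basis_index := enum_val r in bval (tag i) (tagged i))
         (\col_r let u : dep_index := enum_val r in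
                 bval (tag u) (tagged u + rank (tag u))).

Implicit Types beta : 'cV[R]_#|basis_index|.

Definition QP_feasible beta : Prop :=
  forall r, (matQ *m matA *m beta) r ord0 <= vecb r ord0.

Definition QP_objective beta : R := (beta^T *m matA *m beta) ord0 ord0.

Definition QP_minimiser beta : Prop :=
  QP_feasible beta /\
  forall beta', QP_feasible beta' -> QP_objective beta <= QP_objective beta'.

Variables (H : set ('rV[R]_d -> R)).
Variable ip : ('rV[R]_d -> R) -> ('rV[R]_d -> R) -> R.

Definition M_feasible (v : 'rV[R]_d -> R) : Prop :=
  H v /\ forall t i, (i < #|nset t|)%N -> lam t i v <= bval t i.

Definition M_minimiser (v : 'rV[R]_d -> R) : Prop :=
  M_feasible v /\ forall w, M_feasible w -> hnorm ip v <= hnorm ip w.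

Variable Omega : set 'rV[R]_d.

Definition vsol beta : 'rV[R]_d -> R :=
  restr0 Omega
    (fun x => \sum_(i : basis_index) beta (enum_rank i) ord0 * lamK i x).

End Collocation.

(* Main.v *)
Require Import Defs.
From HB Require Import structures.
From mathcomp Require Import all_boot all_order all_algebra.
From mathcomp Require Import all_classical all_reals all_analysis.
From mathcomp Require Import ring lra zify.
Set Implicit Arguments.
Unset Strict Implicit.
Unset Printing Implicit Defensive.
Import Order.TTheory GRing.Theory Num.Theory.
Import numFieldNormedType.Exports.
Local Open Scope classical_set_scope.
Local Open Scope ring_scope.

(** The functionals lambda_i are continuous on H, so each one is the inner
    product with a representer, and that representer is the function
    x |-> (lambda_i)^y Phi(x, y). The matrix A is therefore the Gram matrix of
    these functions, and QA beta <= b says that the function v with coefficients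
    beta satisfies all the constraints of the problem (M), the constraints beyond
    the rank being linear combinations of the others. If A is invertible, then
    every u in H has an orthogonal projection onto the span of the representers,
    on which the functionals take the same values and whose norm is not larger.
    Hence the element
    of least norm of the closed convex set of feasible functions, which exists
    and is unique by the parallelogram law, lies in the span, and the two
    problems have the same solution ([min_norm_quadratic_program]).

    Two analytic facts carry the proof.

    First, functions of H have directional derivatives at points of Omega, and
    these are inner products with an element of H. This follows from the
    convergence of the mixed second difference quotients of the kernel, which
    makes the difference quotients of its sections a Cauchy net
    ([rkhs_derivative], [radial_mixed_difference]). The existence of the limit of
    Psi_1 at 0 enters here: it forces k > 0, so that the derivative of the radial
    profile is again governed by a continuous Wendland function.

    Secondly, A is invertible, because the gradients of the kernel at distinct
    centres are linearly independent ([kernel_gradients_free]). The argument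
    compares singularities. On the line through a centre in the direction of its
    weight, the contribution of this centre has a jump in its derivative of order
    2k, since the first odd power of the polynomial profile phi_{l,k} is
    r^(2k+1). Another centre contributes a jump only if its distance is exactly
    1/c, the radius of the support, where the gradient vanishes to order l+k-1.
    In dimension at least 2 this order exceeds 2k and there is no jump. In
    dimension 1 it equals 2k, but at most two centres are involved, and their
    coefficients are too small to cancel the jump at a centre whose weight is
    maximal ([wendland_centre_dominates]). *)

(** * Wendland functions as truncated polynomials *)

Section WendlandPolynomials.
Variable R : realType.
Implicit Types (p q : {poly R}) (r a b v e : R) (l k n i : nat).

Definition primitive p : {poly R} := 'X * \poly_(i < size p) (p`_i / i.+1%:R).

Lemma coef_primitive p i :
  (primitive p)`_i = if i is i'.+1 then p`_i' / i%:R else 0.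
Proof.
rewrite /primitive coefXM; case: i => //= i; rewrite coef_poly.
by case: ltnP => // /leq_sizeP ->; rewrite ?mul0r.
Qed.

Lemma primitive0 p : (primitive p).[0] = 0.
Proof. by rewrite hornerM hornerX mul0r. Qed.

Lemma deriv_primitive p : (primitive p)^`() = p.
Proof.
apply/polyP => i; rewrite coef_deriv coef_primitive -[_ *+ i.+1]mulr_natr.
by rewrite mulfVK // pnatr_eq0.
Qed.

(** In the variable 1 - r the truncation at r = 1 is the positive part, and the
    order of vanishing at the boundary can be read off the coefficients. *)
Fixpoint wendY l k : {poly R} :=
  if k is k'.+1 then primitive ((1 - 'X) * wendY l k') else 'X^l.

(** The same polynomials in the variable r, for the expansion at the centre. *)
Definition wendX l k : {poly R} := wendY l k \Po (1 - 'X).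

Lemma wendY0 l k : (0 < l + k)%N -> (wendY l k).[0] = 0.
Proof.
case: k => [|k] lk; last exact: primitive0.
by rewrite hornerXn expr0n; case: l lk.
Qed.

Lemma deriv_wendX l k : (wendX l k.+1)^`() = - ('X * wendX l k).
Proof.
rewrite /wendX deriv_comp deriv_primitive derivB derivX (derivC 1).
rewrite comp_polyM comp_polyB (comp_polyC 1) comp_polyX; ring.
Qed.

Lemma Rintegral_deriv p a b : a <= b ->
  \int[lebesgue_measure]_(t in `[a, b]) (p^`()).[t] = p.[b] - p.[a].
Proof.
rewrite le_eqVlt => /predU1P[<-|ab].
  by rewrite set_itv1 Rintegral_set1 subrr.
rewrite /Rintegral (@continuous_FTC2 _ _ (horner p)) //.
- by apply: derivable_within_continuous => x _; exact: derivable_horner.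
- split.
  + by move=> x _; exact: derivable_horner.
  + by apply: cvg_at_right_filter; exact: continuous_horner.
  + by apply: cvg_at_left_filter; exact: continuous_horner.
- by move=> x _; rewrite derivE.
Qed.

Lemma wendlandE l k r : wendland l k r = (wendY l k).[Num.max 0 (1 - r)].
Proof.
elim: k r => [|k IH] r; first by rewrite /= hornerXn.
rewrite [LHS]/=; case: ifPn => r1; last first.
  rewrite -ltNge in r1; rewrite max_l ?wendY0 ?addnS //.
  by rewrite subr_le0 ltW.
have -> : \int[lebesgue_measure]_(t in `[r, 1]) (t * wendland l k t) =
          \int[lebesgue_measure]_(t in `[r, 1]) ((- wendX l k.+1)^`()).[t].
  apply: eq_Rintegral => t /set_mem; rewrite /= in_itv /= => /andP[_ t1].
  rewrite IH max_r ?subr_ge0 // derivN deriv_wendX opprK.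
  by rewrite hornerM hornerX horner_comp !hornerE.
rewrite Rintegral_deriv // !hornerN !horner_comp !hornerE max_r ?subr_ge0 //.
by rewrite subrr; ring.
Qed.

Lemma wendland_le1 l k r : r <= 1 -> wendland l k r = (wendX l k).[r].
Proof.
by move=> r1; rewrite wendlandE max_r ?subr_ge0 // horner_comp !hornerE.
Qed.

Lemma wendland_ge1 l k r : (0 < l + k)%N -> 1 <= r -> wendland l k r = 0.
Proof. by move=> lk r1; rewrite wendlandE max_l ?subr_le0 // wendY0. Qed.

Lemma continuous_wendland l k : continuous (@wendland R l k).
Proof.
move=> x.
have -> : @wendland R l k = horner (wendY l k) \o (fun r => Num.max 0 (1 - r)).
  by apply/funext => r /=; rewrite wendlandE.
apply: continuous_comp; last exact: continuous_horner.
apply: continuous_max; first exact: cst_continuous.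
by apply: cvgB; [exact: cvg_cst|exact: cvg_id].
Qed.

Let wendlandS_incr_le1 l k a b v e : 0 <= a -> a <= b -> b <= 1 ->
  (forall t, a <= t <= b -> `|wendland l k t - v| <= e) ->
  `|wendland l k.+1 a - wendland l k.+1 b - (b ^+ 2 - a ^+ 2) / 2 * v|
    <= (b ^+ 2 - a ^+ 2) / 2 * e.
Proof.
move=> a0 ab b1 H.
have a1 : a <= 1 by lra.
rewrite !wendland_le1 //.
(* Both bounds, for s = 1 and s = -1, say that q s is nondecreasing. *)
pose q (s : R) : {poly R} := s *: (- wendX l k.+1 - (v / 2) *: 'X^2) + (e / 2) *: 'X^2.
have dq s t : (q s)^`().[t] = t * (s * ((wendX l k).[t] - v) + e).
  rewrite /q derivD !derivZ derivB derivN deriv_wendX derivZ derivXn opprK.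
  by rewrite !(hornerE, hornerMn); field.
have mono (s : R) : `|s| = 1 -> (q s).[a] <= (q s).[b].
  move=> s1; have [] := @MVT_segment R (horner (q s)) (horner (deriv (q s))) a b ab.
  - by apply: derivable_within_continuous => x _; exact: derivable_horner.
  move=> c cab E; rewrite -subr_ge0 E dq; move: cab; rewrite in_itv /= => /andP[ac cb].
  rewrite mulr_ge0 ?subr_ge0 // mulr_ge0 ?(le_trans a0 ac) //.
  have := H c; rewrite ac cb => /(_ isT); rewrite wendland_le1 ?(le_trans cb)//.
  by rewrite -[X in X <= e]mul1r -s1 -normrM ler_norml => /andP[h _]; lra.
have := mono 1 (normr1 _); have := mono (-1) (normrN1 _).
rewrite /q !(hornerD, hornerN, hornerZ, hornerXn) ler_norml => h1 h2.
apply/andP; split; lra.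
Qed.

(** Since the derivative of the (k+1)-st function is -r times the k-th one, an
    increment of the former is an average of the latter against t dt. Stated
    with an error bound, this needs no derivative and covers the points 0 and 1. *)
Lemma wendlandS_incr l k a b v e : (0 < l + k)%N -> 0 <= a -> a <= b ->
  (forall t, a <= t <= b -> `|wendland l k t - v| <= e) ->
  `|wendland l k.+1 a - wendland l k.+1 b - (b ^+ 2 - a ^+ 2) / 2 * v|
    <= (b ^+ 2 - a ^+ 2) / 2 * e.
Proof.
move=> lk a0 ab H; have [b1|b1] := leP b 1; first exact: wendlandS_incr_le1.
have ve : `|v| <= e.
  by have := H b; rewrite wendland_ge1 ?(ltW b1) // sub0r normrN ab lexx; apply.
have [a1|a1] := leP 1 a.
  rewrite !wendland_ge1 ?addnS ?(ltW b1) // subrr sub0r normrN normrM ger0_norm.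
    by rewrite ler_wpM2l //; nra.
  by nra.
have H1 t : a <= t <= 1 -> `|wendland l k t - v| <= e.
  by move=> /andP[at_ t1]; apply: H; rewrite at_ (le_trans t1) // ltW.
have := wendlandS_incr_le1 a0 (ltW a1) (lexx _) H1.
rewrite (@wendland_ge1 _ _ 1) ?addnS // (@wendland_ge1 _ _ b) ?addnS ?(ltW b1) //.
move: ve; rewrite !subr0 !ler_norml => /andP[v1 v2] /andP[h1 h2].
have b2 : 0 <= (b ^+ 2 - 1) / 2 by nra.
have := ler_wpM2l b2 v1; have := ler_wpM2l b2 v2.
by move=> h3 h4; apply/andP; split; lra.
Qed.

End WendlandPolynomials.

(** * The first singular coefficients at the centre and at the boundary *)

Section WendlandCoefficients.
Variable R : realType.
Implicit Types (l k i : nat).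

Lemma coef1_wendXS l k : (wendX R l k.+1)`_1 = 0.
Proof.
have := congr1 (fun p : {poly R} => p`_0) (deriv_wendX R l k).
by rewrite coef_deriv coefN coefXM oppr0 mulr1n.
Qed.

Lemma coef_wendXS l k i :
  (wendX R l k.+1)`_i.+2 = - (wendX R l k)`_i / i.+2%:R.
Proof.
have := congr1 (fun p : {poly R} => p`_i.+1) (deriv_wendX R l k).
rewrite /= coef_deriv coefN coefXM /= => <-.
by rewrite -[_ *+ i.+2]mulr_natr mulfK // pnatr_eq0.
Qed.

Lemma coef_wendX_odd l k i : odd i -> (i < k.*2.+1)%N -> (wendX R l k)`_i = 0.
Proof.
elim: k i => [|k IH] [|[|i]] //= oi ik; first exact: coef1_wendXS.
by rewrite coef_wendXS IH ?oppr0 ?mul0r //; lia.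
Qed.

Lemma coef1_wendX0 l : (wendX R l 0)`_1 = - l%:R.
Proof.
have -> : (wendX R l 0)`_1 = ((wendX R l 0)^`()).[0].
  by rewrite horner_coef0 coef_deriv mulr1n.
rewrite /wendX deriv_comp hornerM horner_comp derivB derivX (derivC 1) derivXn.
rewrite hornerMn hornerXn !(hornerD, hornerN, hornerX, hornerC).
by rewrite subr0 expr1n; ring.
Qed.

Lemma coef_wendY_small l k i : (i < l + k)%N -> (wendY R l k)`_i = 0.
Proof.
elim: k i => [|k IH] i /=; first by rewrite addn0 coefXn => /ltn_eqF ->.
rewrite coef_primitive; case: i => // i ilk.
rewrite addnS ltnS in ilk.
rewrite mulrBl mul1r coefB coefXM IH //.
by case: i ilk => [|i] ilk; rewrite ?IH ?subrr ?mul0r //; exact: ltnW.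
Qed.

Lemma coef_wendYS l k :
  (wendY R l k.+1)`_(l + k).+1 = (wendY R l k)`_(l + k) / (l + k).+1%:R.
Proof.
rewrite /= coef_primitive mulrBl mul1r coefB coefXM; congr (_ / _).
case: ifP => // lk0; first by rewrite subr0.
by rewrite (@coef_wendY_small _ _ (l + k).-1) ?subr0 // ltn_predL lt0n lk0.
Qed.

Lemma coef_wendY_gt0 l k : 0 < (wendY R l k)`_(l + k).
Proof.
elim: k => [|k IH]; first by rewrite addn0 coefXn eqxx ltr01.
by rewrite addnS coef_wendYS divr_gt0 ?ltr0n.
Qed.

(** At the centre r = 0 the first odd power has order 2k+1, at the boundary
    r = 1 the first power has order l+k; when these orders agree, the centre is
    more singular. *)
Lemma wendland_centre_dominates l k : (1 < l)%N -> (k < l)%N ->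
  (wendY R l k)`_(l + k) < `|(wendX R l k)`_(k.*2.+1)|.
Proof.
move=> l1; elim: k => [_|k IH kl].
  rewrite addn0 coefXn eqxx coef1_wendX0 normrN ger0_norm //.
  by rewrite ltr1n.
rewrite addnS coef_wendYS doubleS coef_wendXS normrM normrN normfV.
rewrite (ger0_norm (ler0n _ _)).
rewrite (@lt_le_trans _ _ (`|(wendX R l k)`_(k.*2.+1)| / (l + k).+1%:R)) //.
  by rewrite ltr_pM2r ?invr_gt0 ?ltr0n // IH // ltnW.
by rewrite ler_wpM2l // lef_pV2 ?posrE ?ltr0n // ler_nat; lia.
Qed.

Lemma coef_wendX_centre_neq0 l k : (0 < l)%N -> (wendX R l k)`_(k.*2.+1) != 0.
Proof.
move=> l0; elim: k => [|k IH].
  by rewrite coef1_wendX0 oppr_eq0 pnatr_eq0 -lt0n.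
by rewrite doubleS coef_wendXS mulf_neq0 ?oppr_eq0 // invr_eq0 pnatr_eq0.
Qed.

End WendlandCoefficients.

(** * Jumps of higher derivatives *)

Section Jumps.
Variable R : realType.
Implicit Types (p q : {poly R}) (g h : R -> R) (J : R) (n : nat).

(** The n-th derivative of g jumps by n! J at 0, expressed without
    derivatives: g is a polynomial plus J s_+^n up to O(s^(n+1)). For n = 0 this
    does not determine J, since s_+^0 = 1 on both sides of 0. *)
Definition has_jump n g J := exists p (B : R),
  \forall s \near (0 : R),
    `|g s - (p.[s] + J * Num.max 0 s ^+ n)| <= B * `|s| ^+ n.+1.

Lemma has_jumpP n g J p B : (\forall s \near (0 : R),
    `|g s - (p.[s] + J * Num.max 0 s ^+ n)| <= B * `|s| ^+ n.+1) ->
  has_jump n g J.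
Proof. by exists p, B. Qed.

Lemma near0_lt (e : R) : 0 < e -> \forall s \near (0 : R), `|s| < e.
Proof. by move=> e0; exact: nbhs0_lt. Qed.

Lemma eq_near_jump n g h J : (\forall s \near (0 : R), g s = h s) ->
  has_jump n g J -> has_jump n h J.
Proof.
move=> gh [p [B gp]]; exists p, B; near=> s.
by have <- : g s = h s; near: s.
Unshelve. all: by end_near. Qed.

Lemma has_jump_big_O n g B :
  (\forall s \near (0 : R), `|g s| <= B * `|s| ^+ n.+1) -> has_jump n g 0.
Proof.
move=> gO; apply: (@has_jumpP _ _ _ 0 B); near=> s.
by rewrite horner0 mul0r addr0 subr0; near: s.
Unshelve. all: by end_near. Qed.

Lemma has_jump_horner n p : has_jump n (horner p) 0.
Proof.
apply: (@has_jumpP _ _ _ p 0); near=> s.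
by rewrite mul0r addr0 subrr normr0 mul0r.
Unshelve. all: by end_near. Qed.

Lemma has_jump_max n : has_jump n (fun s => Num.max 0 s ^+ n) 1.
Proof.
apply: (@has_jumpP _ _ _ 0 0); near=> s.
by rewrite horner0 add0r mul1r subrr normr0 mul0r.
Unshelve. all: by end_near. Qed.

Lemma has_jumpD n g h J K :
  has_jump n g J -> has_jump n h K -> has_jump n (fun s => g s + h s) (J + K).
Proof.
move=> [p [B gp]] [q [C hq]]; apply: (@has_jumpP _ _ _ (p + q) (B + C)).
near=> s.
have -> : g s + h s - ((p + q).[s] + (J + K) * Num.max 0 s ^+ n) =
  (g s - (p.[s] + J * Num.max 0 s ^+ n)) + (h s - (q.[s] + K * Num.max 0 s ^+ n)).
  by rewrite hornerD; ring.
by rewrite mulrDl (le_trans (ler_normD _ _))// lerD//; near: s.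
Unshelve. all: by end_near. Qed.

Lemma has_jump_sum n (I : Type) (r : seq I) (P : pred I) (g : I -> R -> R)
    (J : I -> R) : (forall i, P i -> has_jump n (g i) (J i)) ->
  has_jump n (fun s => \sum_(i <- r | P i) g i s) (\sum_(i <- r | P i) J i).
Proof.
move=> gJ; elim: r => [|i r IH].
  rewrite big_nil; apply: eq_near_jump (has_jump_horner n 0); near=> s.
  by rewrite horner0 big_nil.
rewrite big_cons; case: ifP => Pi.
  apply: eq_near_jump (has_jumpD (gJ i Pi) IH); near=> s.
  by rewrite big_cons Pi.
by apply: eq_near_jump IH; near=> s; rewrite big_cons Pi.
Unshelve. all: by end_near. Qed.

Lemma horner_bounded p : exists2 B : R, 0 <= B & forall s, `|s| <= 1 -> `|p.[s]| <= B.
Proof.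
elim/poly_ind: p => [|p c [B B0 pB]].
  by exists 0 => // s _; rewrite horner0 normr0.
exists (B + `|c|); first by rewrite addr_ge0.
move=> s s1; rewrite hornerMXaddC (le_trans (ler_normD _ _))// lerD2r normrM.
by rewrite -[B]mulr1 ler_pM //; exact: pB.
Qed.

Lemma max0_le_norm n (s : R) : `|Num.max 0 s ^+ n| <= `|s| ^+ n.
Proof.
rewrite normrX lerXn2r ?nnegrE //.
by case: (leP 0 s) => // s0; rewrite normr0.
Qed.

Lemma poly_split_const p : exists p', p = p.[0]%:P + 'X * p'.
Proof.
exists (\poly_(i < size p) p`_i.+1).
apply/polyP => -[|i]; rewrite coefD coefC coefXM /= ?horner_coef0 ?addr0 //.
rewrite add0r coef_poly; case: ltnP => // pi; apply/leq_sizeP: (leqnn i.+1).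
exact: leqW.
Qed.

Lemma has_jump_ge0 n g J : has_jump n g J -> exists p, exists2 B, 0 <= B &
  \forall s \near (0 : R),
    `|g s - (p.[s] + J * Num.max 0 s ^+ n)| <= B * `|s| ^+ n.+1.
Proof.
move=> [p [B gp]]; exists p, `|B| => //; near=> s.
have : `|g s - (p.[s] + J * Num.max 0 s ^+ n)| <= B * `|s| ^+ n.+1 by near: s.
move=> /le_trans; apply; rewrite ler_wpM2r ?exprn_ge0 //; exact: ler_norm.
Unshelve. all: by end_near. Qed.

(** Only the values at 0 of the two factors enter, because s s_+^n = O(s^(n+1)). *)
Lemma has_jumpM n g h J K : (0 < n)%N ->
  has_jump n g J -> has_jump n h K ->
  has_jump n (fun s => g s * h s) (J * h 0 + K * g 0).
Proof.
move=> n0 /has_jump_ge0[p [B B0 gp]] /has_jump_ge0[q [C C0 hq]].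
have val0 f r L D : (\forall s \near (0 : R),
    `|f s - (r.[s] + L * Num.max 0 s ^+ n)| <= D * `|s| ^+ n.+1) -> r.[0] = f 0.
  move=> /nbhs_singleton; rewrite maxxx normr0 exprS mul0r expr0n gtn_eqF //.
  by rewrite !mulr0 addr0 normr_le0 subr_eq0 => /eqP.
have pg := val0 _ _ _ _ gp; have qh := val0 _ _ _ _ hq.
have [P P0 pP] := horner_bounded p; have [Q Q0 qQ] := horner_bounded q.
have [p' pE] := poly_split_const p; have [q' qE] := poly_split_const q.
have [P' P'0 pP'] := horner_bounded p'; have [Q' Q'0 qQ'] := horner_bounded q'.
apply: (@has_jumpP _ _ _ (p * q)
  (`|K| * P' + `|J| * Q' + P * C + `|J * K| + `|J| * C + B * (Q + `|K| + C))).
near=> s.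
have s1 : `|s| <= 1 by apply/ltW; near: s; exact: near0_lt.
pose a := g s - (p.[s] + J * Num.max 0 s ^+ n).
pose b := h s - (q.[s] + K * Num.max 0 s ^+ n).
have aB : `|a| <= B * `|s| ^+ n.+1 by rewrite /a; near: s.
have bC : `|b| <= C * `|s| ^+ n.+1 by rewrite /b; near: s.
set m := Num.max 0 s ^+ n.
have mn : `|m| <= `|s| ^+ n by exact: max0_le_norm.
have sn1 : `|s| ^+ n <= 1 by rewrite exprn_ile1.
have sn2 : `|s| ^+ n.+1 <= 1 by rewrite exprn_ile1.
have m1 : `|m| <= 1 by rewrite (le_trans mn).
have Bs : 0 <= B * `|s| ^+ n.+1 by rewrite (le_trans _ aB).
have Cs : 0 <= C * `|s| ^+ n.+1 by rewrite (le_trans _ bC).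
have -> : g s * h s - ((p * q).[s] + (J * h 0 + K * g 0) * m) =
  K * (m * (s * p'.[s])) + J * (m * (s * q'.[s])) + p.[s] * b + J * K * (m * m)
  + J * m * b + a * (q.[s] + K * m + b).
  have ps : p.[s] = g 0 + s * p'.[s].
    by rewrite {1}pE pg hornerD hornerC hornerM hornerX.
  have qs : q.[s] = h 0 + s * q'.[s].
    by rewrite {1}qE qh hornerD hornerC hornerM hornerX.
  by rewrite hornerM /a /b -/m ps qs; ring.
have T1 (x y D : R) : `|y| <= D -> `|x * (m * (s * y))| <= `|x| * D * `|s| ^+ n.+1.
  move=> yD; have -> : `|x| * D * `|s| ^+ n.+1 = `|x| * (`|s| ^+ n * (`|s| * D)).
    by rewrite exprS; ring.
  by rewrite !normrM ler_wpM2l // ler_pM ?mulr_ge0 // ler_wpM2l.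
rewrite !mulrDl.
rewrite (le_trans (ler_normD _ _))// lerD //.
  rewrite (le_trans (ler_normD _ _))// lerD //.
    rewrite (le_trans (ler_normD _ _))// lerD //.
      rewrite (le_trans (ler_normD _ _))// lerD //.
        by rewrite (le_trans (ler_normD _ _))// lerD // T1 // ?pP' ?qQ'.
      by rewrite normrM -mulrA ler_pM // pP.
    rewrite normrM ler_wpM2l // normrM exprSr ler_pM // (le_trans mn) //.
    by case: (n) n0 => // n' _; rewrite exprS ler_piMr // exprn_ile1.
  rewrite !normrM -!mulrA ler_wpM2l // -[X in _ <= X]mul1r.
  by rewrite ler_pM.
have hB : `|q.[s] + K * m + b| <= Q + `|K| + C.
  apply: le_trans (ler_normD _ _) _; apply: lerD; last first.
    by apply: le_trans bC _; rewrite -[X in _ <= X]mulr1 ler_wpM2l.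
  apply: le_trans (ler_normD _ _) _; apply: lerD; first exact: qQ.
  by rewrite normrM -[X in _ <= X]mulr1 ler_wpM2l.
by rewrite -!mulrDl normrM -mulrA [_ * `|s| ^+ _]mulrC mulrA ler_pM.
Unshelve. all: by end_near. Qed.

Lemma has_jumpZ n g J (a : R) : has_jump n g J -> has_jump n (fun s => a * g s) (a * J).
Proof.
move=> [p [B gp]]; apply: (@has_jumpP _ _ _ (a *: p) (`|a| * B)); near=> s.
have -> : a * g s - ((a *: p).[s] + a * J * Num.max 0 s ^+ n) =
    a * (g s - (p.[s] + J * Num.max 0 s ^+ n)) by rewrite hornerZ; ring.
by rewrite normrM -mulrA ler_wpM2l //; near: s.
Unshelve. all: by end_near. Qed.

Lemma has_jump_horner_comp n g q : (0 < n)%N ->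
  has_jump n g 0 -> has_jump n (fun s => q.[g s]) 0.
Proof.
move=> n0 gn; elim/poly_ind: q => [|q c IH].
  apply: eq_near_jump (has_jump_horner n 0); near=> s.
  by rewrite !horner0.
have := has_jumpD (has_jumpM n0 IH gn) (has_jump_horner n c%:P).
rewrite !mul0r !addr0; apply: eq_near_jump; near=> s.
by rewrite hornerMXaddC hornerC.
Unshelve. all: by end_near. Qed.

(** The Taylor polynomial of sqrt q is computed coefficient by coefficient. *)
Lemma poly_sqrt_approx q n (a : R) : 0 < a -> q.[0] = a ^+ 2 ->
  exists p r : {poly R}, p.[0] = a /\ q = p ^+ 2 + 'X^(n.+1) * r.
Proof.
move=> a0 qa; elim: n => [|n [p [r [pa qp]]]].
  have [r qE] := poly_split_const q.
  exists a%:P, r; rewrite hornerC; split=> //.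
  by rewrite {1}qE qa polyC_exp.
have [r' rE] := poly_split_const r.
pose c := r.[0] / (2 * a).
have [p' pE] := poly_split_const p; rewrite pa in pE.
exists (p + c *: 'X^(n.+1)), (r' - (2 * c) *: p' - (c ^+ 2) *: 'X^n); split.
  by rewrite hornerD hornerZ hornerXn expr0n mulr0 addr0.
rewrite [LHS]qp; have -> : r = (2 * c * a)%:P + 'X * r'.
  by rewrite {1}rE; congr (_%:P + _); rewrite /c; field; rewrite gt_eqF.
rewrite pE -!mul_polyC !polyCM !exprS; ring.
Qed.

Lemma has_jump_sqrt n q : 0 < q.[0] -> has_jump n (fun s => Num.sqrt q.[s]) 0.
Proof.
move=> q0; have a0 : 0 < Num.sqrt q.[0] by rewrite sqrtr_gt0.
have [|p [r [pa qE]]] := @poly_sqrt_approx q n _ a0.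
  by rewrite sqr_sqrtr // ltW.
have [B B0 rB] := horner_bounded r.
apply: (@has_jumpP _ _ _ p (B / (Num.sqrt q.[0] / 2))); near=> s.
have s1 : `|s| <= 1 by apply/ltW; near: s; exact: near0_lt.
have ps : Num.sqrt q.[0] / 2 < p.[s].
  near: s; apply: (cvgr_gt _ (@continuous_horner _ p 0)).
  by rewrite pa; lra.
have qs : 0 < q.[s].
  near: s; exact: (cvgr_gt _ (@continuous_horner _ q 0)).
rewrite mul0r addr0.
have S0 : 0 <= Num.sqrt q.[s] by exact: sqrtr_ge0.
have d0 : 0 < Num.sqrt q.[s] + p.[s] by lra.
have -> : Num.sqrt q.[s] - p.[s] = s ^+ n.+1 * r.[s] / (Num.sqrt q.[s] + p.[s]).
  rewrite -[LHS](mulfK (lt0r_neq0 d0)); congr (_ / _).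
  have := sqr_sqrtr (ltW qs); rewrite {2}qE hornerD horner_exp hornerM hornerXn.
  by move=> E; rewrite -subr_sqr E addrAC subrr add0r.
rewrite normrM normrM normfV normrX (gtr0_norm d0).
rewrite [X in _ <= X]mulrC -mulrA ler_wpM2l ?exprn_ge0 // ler_pM ?invr_ge0 ?(ltW d0) //.
  exact: rB.
by rewrite lef_pV2 ?posrE //; lra.
Unshelve. all: by end_near. Qed.

Lemma small_eq0 (x D e : R) : 0 < e ->
  (forall t, 0 < t -> t < e -> `|x| <= D * t) -> x = 0.
Proof.
move=> e0 H; apply/eqP; rewrite -normr_le0 leNgt; apply/negP => x0.
have D0 : 0 < 2 * (`|D| + 1) by rewrite mulr_gt0 // ltr_wpDl.
pose t := Num.min (e / 2) (`|x| / (2 * (`|D| + 1))).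
have t0 : 0 < t by rewrite lt_min !divr_gt0.
have te : t < e by rewrite (@le_lt_trans _ _ (e / 2)) ?ge_min ?lexx //; lra.
have tx : t * (2 * (`|D| + 1)) <= `|x| by rewrite -ler_pdivlMr // ge_min lexx orbT.
have := H _ t0 te; have := ler_norm D; have := normr_ge0 D; nra.
Qed.

Lemma poly_small_divisible p (B e : R) n : 0 < e ->
  (forall t, 0 < t -> t < e -> `|p.[- t]| <= B * t ^+ n) ->
  exists q, p = 'X^n * q.
Proof.
elim: n p B e => [|n IH] p B e e0 H; first by exists p; rewrite mul1r.
have [p' pE] := poly_split_const p; have [P P0 pP] := horner_bounded p'.
have ps t : p.[- t] = p.[0] - t * p'.[- t].
  by rewrite {1}pE hornerD hornerC hornerM hornerX mulNr.
have e1 : 0 < Num.min e 1 by rewrite lt_min e0 ltr01.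
have p0 : p.[0] = 0.
  apply: (small_eq0 e1 (D := `|B| + P)) => t t0; rewrite lt_min => /andP[te /ltW t1].
  have t0' := ltW t0; have -> : p.[0] = p.[- t] + t * p'.[- t] by rewrite ps subrK.
  rewrite mulrDl; apply: le_trans (ler_normD _ _) _; apply: lerD.
    apply: le_trans (H t t0 te) _.
    apply: (@le_trans _ _ (`|B| * t ^+ n.+1)).
      by rewrite ler_wpM2r ?exprn_ge0 // ler_norm.
    by rewrite ler_wpM2l // exprS ler_piMr // exprn_ile1.
  by rewrite normrM gtr0_norm // mulrC ler_wpM2r // pP // normrN gtr0_norm.
have [|q p'E] := IH p' B e e0.
  move=> t t0 te; have := H t t0 te; rewrite ps p0 sub0r normrN normrM.
  by rewrite gtr0_norm // exprS mulrCA ler_pM2l.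
by exists q; rewrite pE p0 add0r p'E exprS mulrA.
Qed.

(** Looking at s < 0 shows that the polynomial part is O(s^(n+1)); then s > 0
    shows that the jump vanishes. *)
Lemma has_jump_unique0 n J : (0 < n)%N -> has_jump n (fun=> 0) J -> J = 0.
Proof.
move=> n0 /has_jump_ge0[p [B B0 /nbhs_ballP[e /= e0 H]]].
have {}H s : `|s| < e -> `|p.[s] + J * Num.max 0 s ^+ n| <= B * `|s| ^+ n.+1.
  by move=> se; have := H s; rewrite /ball /= !sub0r !normrN; apply.
have e1 : 0 < Num.min e 1 by rewrite lt_min e0 ltr01.
have [|q pE] := @poly_small_divisible p B e n.+1 e0.
  move=> t t0 te; have := H (- t); rewrite normrN gtr0_norm // max_l; last by lra.
  by rewrite expr0n gtn_eqF // mulr0 addr0; apply.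
have [Q Q0 qQ] := horner_bounded q.
apply: (small_eq0 e1 (D := B + Q)) => t t0; rewrite lt_min => /andP[te t1].
have tn : 0 < t ^+ n by rewrite exprn_gt0.
rewrite -(ler_pM2r tn) -mulrA -exprS -[X in _ * X](gtr0_norm tn) -normrM.
have := H t; rewrite (gtr0_norm t0) max_r ?(ltW t0) // => /(_ te) h.
have -> : J * t ^+ n = (p.[t] + J * t ^+ n) - t ^+ n.+1 * q.[t].
  by rewrite {1}pE hornerM hornerXn; ring.
apply: le_trans (ler_normB _ _) _; rewrite mulrDl; apply: lerD => //.
by rewrite normrM mulrC ler_pM // ?qQ // ?gtr0_norm ?exprn_gt0 // ltW.
Qed.

(** This is how the odd singularity of the profile at a centre is transported to
    its gradient. *)
Lemma has_jump_shift n g J : (0 < n)%N ->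
  has_jump n g J -> has_jump n.+1 (fun s => s * g s) J.
Proof.
move=> n0 [p [B gp]]; apply: (@has_jumpP _ _ _ ('X * p) B); near=> s.
have -> : s * g s - (('X * p).[s] + J * Num.max 0 s ^+ n.+1) =
    s * (g s - (p.[s] + J * Num.max 0 s ^+ n)).
  rewrite hornerM hornerX exprS; case: (leP 0 s) => s0; first ring.
  by rewrite expr0n gtn_eqF // mulr0n; ring.
by rewrite normrM exprS mulrCA ler_wpM2l //; near: s.
Unshelve. all: by end_near. Qed.

(** For odd n, |s|^n = 2 s_+^n - s^n. *)
Lemma has_jump_odd_norm n : odd n -> has_jump n (fun s => `|s| ^+ n) 2.
Proof.
move=> on; apply: (@has_jumpP _ _ _ (- 'X^n) 0); near=> s.
rewrite mul0r normr_le0 hornerN hornerXn; case: (leP 0 s) => s0.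
  by apply/eqP; rewrite ger0_norm //; ring.
rewrite ltr0_norm // expr0n gtn_eqF ?mulr0 ?addr0; last by case: n on.
by rewrite exprNn -signr_odd on expr1 mulN1r subrr.
Unshelve. all: by end_near. Qed.

(** Even powers of |s| are polynomials and powers above n are O(s^(n+1)), so
    only the coefficient of order n contributes. *)
Lemma has_jump_horner_norm n p (a : R) : odd n ->
  (forall i, odd i -> (i < n)%N -> p`_i = 0) -> 0 <= a ->
  has_jump n (fun s => p.[a * `|s|]) (2 * p`_n * a ^+ n).
Proof.
move=> on p0 a0.
have mono i : has_jump n (fun s => p`_i * (a * `|s|) ^+ i)
    (if i == n then 2 * p`_n * a ^+ n else 0).
  have := fun J => @has_jumpZ n (fun s => `|s| ^+ i) J (p`_i * a ^+ i).
  have Eq : (fun s : R => p`_i * a ^+ i * `|s| ^+ i) =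
      (fun s : R => p`_i * (a * `|s|) ^+ i).
    by apply/funext => s; rewrite exprMn mulrA.
  rewrite Eq => jZ; case: eqP => [ni|/eqP ni].
    have -> : 2 * p`_n * a ^+ n = p`_i * a ^+ i * 2 by rewrite ni; ring.
    by apply: jZ; rewrite ni; exact: has_jump_odd_norm.
  rewrite -[X in has_jump _ _ X](mulr0 (p`_i * a ^+ i)).
  have [oi|ei] := boolP (odd i); last first.
    apply: jZ; apply: eq_near_jump (has_jump_horner n 'X^i); near=> s.
    by rewrite hornerXn -normrX ger0_norm ?exprn_even_ge0.
  case: (ltngtP i n) ni => // [lin|lni] _.
    rewrite -Eq p0 // !mul0r; apply: eq_near_jump (has_jump_horner n 0).
    by near=> s; rewrite horner0 !mul0r.
  apply: jZ; apply: (@has_jump_big_O _ _ 1); near=> s.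
  have s1 : `|s| <= 1 by apply/ltW; near: s; exact: near0_lt.
  by rewrite mul1r normrX normr_id ler_wiXn2l.
pose N := maxn n.+1 (size p).
have -> : (fun s : R => p.[a * `|s|]) = fun s : R => \sum_(i < N) p`_i * (a * `|s|) ^+ i.
  by apply/funext => s; rewrite (horner_coef_wide _ (leq_maxr n.+1 _)).
have nN : (n < N)%N by exact: leq_maxl.
have -> : 2 * p`_n * a ^+ n =
    \sum_(i < N) (if i == n :> nat then 2 * p`_n * a ^+ n else 0).
  by rewrite -big_mkcond /= (big_pred1 (Ordinal nN)).
by apply: has_jump_sum => i _; exact: mono.
Unshelve. all: by end_near. Qed.

End Jumps.

(** * Reproducing kernel Hilbert spaces *)

Lemma open_near_line (R : realType) (d : nat) (Omega : set 'rV[R]_d) (y e : 'rV[R]_d) :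
  open Omega -> Omega y -> \forall h \near (0 : R), Omega (h *: e + y).
Proof.
move=> oOmega Oy; have c : (fun h : R => h *: e + y) @ 0 --> 0 *: e + y.
  by apply: cvgD; [apply: cvgZr_tmp; exact: cvg_id|exact: cvg_cst].
by apply: c; rewrite scale0r add0r; exact: open_nbhs_nbhs.
Qed.

Section RKHSTheory.
Variables (R : realType) (d : nat) (Omega : set 'rV[R]_d).
Variables (K : 'rV[R]_d -> 'rV[R]_d -> R) (H : set ('rV[R]_d -> R)).
Variable ip : ('rV[R]_d -> R) -> ('rV[R]_d -> R) -> R.
Hypothesis hH : is_RKHS Omega K H ip.
Implicit Types (u v w : 'rV[R]_d -> R) (a : R).

Lemma rkhs_scale a u : H u -> H (fun x => a * u x).
Proof.
move=> Hu; have := rkhs_lin hH a Hu (rkhs_0 hH).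
by congr H; apply/funext => x; rewrite addr0.
Qed.

Lemma rkhs_sub u v : H u -> H v -> H (fun x => u x - v x).
Proof.
move=> Hu Hv; have := rkhs_lin hH (-1) Hv Hu.
by congr H; apply/funext => x; rewrite mulN1r addrC.
Qed.

Lemma rkhs_ip0l w : H w -> ip (fun=> 0) w = 0.
Proof.
move=> Hw; have := rkhs_ip_lin hH 1 (rkhs_0 hH) (rkhs_0 hH) Hw.
have -> : (fun x : 'rV[R]_d => 1 * 0 + 0 : R) = fun=> 0.
  by apply/funext => x; rewrite mulr0 addr0.
by rewrite mul1r => /esym/eqP; rewrite -subr_eq0 addrK => /eqP.
Qed.

Lemma rkhs_ipZl a u w : H u -> H w -> ip (fun x => a * u x) w = a * ip u w.
Proof.
move=> Hu Hw; rewrite -[RHS]addr0 -(rkhs_ip0l Hw).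
rewrite -(rkhs_ip_lin hH a Hu (rkhs_0 hH) Hw).
by congr (ip _ w); apply/funext => x; rewrite addr0.
Qed.

Lemma rkhs_ipBl u v w : H u -> H v -> H w ->
  ip (fun x => u x - v x) w = ip u w - ip v w.
Proof.
move=> Hu Hv Hw; have -> : ip u w - ip v w = -1 * ip v w + ip u w by ring.
rewrite -(rkhs_ip_lin hH (-1) Hv Hu Hw).
by congr (ip _ w); apply/funext => x; rewrite mulN1r addrC.
Qed.

Lemma rkhs_ipBr u v w : H u -> H v -> H w ->
  ip w (fun x => u x - v x) = ip w u - ip w v.
Proof.
move=> Hu Hv Hw; rewrite (rkhs_ip_sym hH) ?rkhs_ipBl //; last exact: rkhs_sub.
by rewrite !(rkhs_ip_sym hH Hw).
Qed.

Lemma rkhs_ipZr a u w : H u -> H w -> ip w (fun x => a * u x) = a * ip w u.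
Proof.
move=> Hu Hw; rewrite (rkhs_ip_sym hH) ?rkhs_ipZl //; last exact: rkhs_scale.
by rewrite (rkhs_ip_sym hH Hw).
Qed.

Section Combinations.
Variables (I : Type) (r : seq I) (P : pred I) (a : I -> R).
Variables (u : I -> 'rV[R]_d -> R).
Hypothesis Hu : forall i, P i -> H (u i).

Lemma rkhs_sum_ip w : H w -> H (fun x => \sum_(i <- r | P i) a i * u i x) /\
  ip (fun x => \sum_(i <- r | P i) a i * u i x) w =
  \sum_(i <- r | P i) a i * ip (u i) w.
Proof.
move=> Hw; elim: r => [|i s [IH1 IH2]].
  rewrite big_nil; have -> : (fun x : 'rV[R]_d => \sum_(i <- [::] | P i) a i * u i x)
      = (fun=> 0) by apply/funext => x; rewrite big_nil.
  by split; [exact: rkhs_0 hH|rewrite rkhs_ip0l].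
rewrite big_cons; case: ifP => Pi.
  have -> : (fun x => \sum_(i <- i :: s | P i) a i * u i x) =
      (fun x => a i * u i x + \sum_(i <- s | P i) a i * u i x).
    by apply/funext => x; rewrite big_cons Pi.
  split; first by apply: (rkhs_lin hH) => //; exact: Hu.
  by rewrite (rkhs_ip_lin hH) ?IH2 //; exact: Hu.
have -> : (fun x => \sum_(i <- i :: s | P i) a i * u i x) =
    (fun x => \sum_(i <- s | P i) a i * u i x).
  by apply/funext => x; rewrite big_cons Pi.
by [].
Qed.

Lemma rkhs_sum : H (fun x => \sum_(i <- r | P i) a i * u i x).
Proof. by have [] := rkhs_sum_ip (rkhs_0 hH). Qed.

Lemma rkhs_ip_suml w : H w -> ip (fun x => \sum_(i <- r | P i) a i * u i x) w =
  \sum_(i <- r | P i) a i * ip (u i) w.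
Proof. by move=> /rkhs_sum_ip[]. Qed.

Lemma rkhs_ip_sumr w : H w -> ip w (fun x => \sum_(i <- r | P i) a i * u i x) =
  \sum_(i <- r | P i) a i * ip w (u i).
Proof.
move=> Hw; rewrite (rkhs_ip_sym hH) ?rkhs_ip_suml //; last exact: rkhs_sum.
by apply: eq_bigr => i Pi; rewrite (rkhs_ip_sym hH) //; exact: Hu.
Qed.

End Combinations.

Lemma rkhs_sqnormB u v : H u -> H v ->
  ip (fun x => u x - v x) (fun x => u x - v x) =
  ip u u - 2 * ip u v + ip v v.
Proof.
move=> Hu Hv; rewrite rkhs_ipBl ?rkhs_ipBr //; last exact: rkhs_sub.
by rewrite (rkhs_ip_sym hH Hv Hu); ring.
Qed.

Lemma rkhs_cauchy_schwarz u v : H u -> H v -> ip u v ^+ 2 <= ip u u * ip v v.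
Proof.
move=> Hu Hv; have v0 := rkhs_ip_ge0 hH Hv.
have [vv0|vvn0] := eqVneq (ip v v) 0.
  have E := rkhs_ip_eq0 hH Hv vv0; rewrite vv0 mulr0 E (rkhs_ip_sym hH Hu (rkhs_0 hH)).
  by rewrite rkhs_ip0l // expr0n.
have vp : 0 < ip v v by rewrite lt_def vvn0.
pose t := ip u v / ip v v.
have Htv : H (fun x => t * v x) by exact: rkhs_scale.
have := rkhs_ip_ge0 hH (rkhs_sub Hu Htv).
rewrite rkhs_sqnormB // rkhs_ipZl // !rkhs_ipZr //.
have -> : ip u u - 2 * (t * ip u v) + t * (t * ip v v) =
    (ip u u * ip v v - ip u v ^+ 2) / ip v v by rewrite /t; field.
by rewrite pmulr_lge0 ?invr_gt0 // subr_ge0.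
Qed.

(** Squared norms replace norms: this is the triangle inequality up to a
    factor 2, and needs no square roots. *)
Lemma rkhs_sqnorm_triangle u v w : H u -> H v -> H w ->
  ip (fun x => u x - w x) (fun x => u x - w x) <=
  2 * ip (fun x => u x - v x) (fun x => u x - v x) +
  2 * ip (fun x => v x - w x) (fun x => v x - w x).
Proof.
move=> Hu Hv Hw; have := rkhs_ip_ge0 hH (rkhs_sub (rkhs_sub Hu Hv) (rkhs_sub Hv Hw)).
rewrite rkhs_sqnormB; try exact: rkhs_sub.
rewrite !rkhs_sqnormB // !rkhs_ipBl ?rkhs_ipBr //; last exact: rkhs_sub.
by lra.
Qed.

Lemma rkhs_complete_sq (u : nat -> 'rV[R]_d -> R) : (forall n, H (u n)) ->
  (forall e, 0 < e -> exists N, forall m n, (N <= m)%N -> (N <= n)%N ->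
    ip (fun x => u m x - u n x) (fun x => u m x - u n x) < e) ->
  exists2 v, H v & forall e, 0 < e -> exists N, forall n, (N <= n)%N ->
    ip (fun x => u n x - v x) (fun x => u n x - v x) < e.
Proof.
move=> Hu cu; have [|v Hv uv] := rkhs_complete hH Hu.
  move=> e e0; have e20 : 0 < e ^+ 2 by rewrite exprn_gt0.
  have [N HN] := cu _ e20; exists N => m n Nm Nn.
  by rewrite /hnorm -[e]gtr0_norm // -sqrtr_sqr ltr_sqrt // HN.
exists v => // e e0.
have se0 : 0 < Num.sqrt e by rewrite sqrtr_gt0.
have /cvgrPdist_lt/(_ _ se0) [N _ HN] := uv.
exists N => n Nn; have := HN n Nn; rewrite /= sub0r normrN /hnorm ger0_norm ?sqrtr_ge0 //.
by rewrite ltr_sqrt.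
Qed.

Lemma rkhs_sqnorm_mid u v : H u -> H v ->
  ip (fun x => 2^-1 * u x + 2^-1 * v x) (fun x => 2^-1 * u x + 2^-1 * v x) =
  (ip u u + 2 * ip u v + ip v v) / 4.
Proof.
move=> Hu Hv; have Hv' := rkhs_scale 2^-1 Hv.
have Hm := rkhs_lin hH 2^-1 Hu Hv'.
rewrite (rkhs_ip_lin hH) // !(rkhs_ip_sym hH _ Hm) //.
rewrite !(rkhs_ip_lin hH) // !rkhs_ipZl ?rkhs_ipZr // (rkhs_ip_sym hH Hv Hu).
by field.
Qed.

(** A minimising sequence is Cauchy by the parallelogram law, since midpoints
    stay in S. *)
Lemma rkhs_min_norm (S : set ('rV[R]_d -> R)) : S !=set0 ->
  (forall u, S u -> H u) ->
  (forall u v, S u -> S v -> S (fun x => 2^-1 * u x + 2^-1 * v x)) ->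
  (forall (u : nat -> 'rV[R]_d -> R) v, (forall n, S (u n)) -> H v ->
    (forall e, 0 < e -> exists N, forall n, (N <= n)%N ->
      ip (fun x => u n x - v x) (fun x => u n x - v x) < e) -> S v) ->
  exists2 v, S v & forall w, S w -> ip v v <= ip w w.
Proof.
move=> [u0 Su0] SH Smid Sclosed.
pose E : set R := [set ip w w | w in S].
have lbE : lbound E 0 by move=> _ [w Sw <-]; exact: (rkhs_ip_ge0 hH (SH _ Sw)).
have infE : has_inf E by split; [exists (ip u0 u0), u0|exists 0].
pose m := inf E.
have mle w : S w -> m <= ip w w by move=> Sw; apply: ge_inf; [exists 0|exists w].
have Hadh (n : nat) : exists u, S u /\ ip u u < m + n.+1%:R^-1.
  have n0 : 0 < n.+1%:R^-1 :> R by rewrite invr_gt0 ltr0n.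
  by have [_ [u Su <-] um] := inf_adherent n0 infE; exists u.
have [u Hu] := choice Hadh.
have small e : 0 < e -> exists N, forall n, (N <= n)%N -> ip (u n) (u n) < m + e.
  move=> e0; exists `|Num.ceil e^-1|%N => n Nn.
  apply: lt_le_trans (Hu n).2 _; rewrite lerD2l -[e]invrK lef_pV2 ?posrE ?invr_gt0 //.
  apply: (@le_trans _ _ `|Num.ceil e^-1|%N%:R); last by rewrite ler_nat leqW.
  rewrite natr_absz ger0_norm ?ceil_ge //.
  by rewrite ceil_ge0 (lt_trans (ltrN10 _)) // invr_gt0.
have [e e0|v Hv uv] := @rkhs_complete_sq u (fun n => SH _ (Hu n).1).
  have e4 : 0 < e / 4 by rewrite divr_gt0.
  have [N HN] := small _ e4; exists N => i j Ni Nj.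
  rewrite rkhs_sqnormB; try exact: (SH _ (Hu _).1).
  have := mle _ (Smid _ _ (Hu i).1 (Hu j).1).
  rewrite rkhs_sqnorm_mid; try exact: (SH _ (Hu _).1).
  by have := HN _ Ni; have := HN _ Nj; lra.
have Sv : S v by apply: (Sclosed u) => // n; exact: (Hu n).1.
exists v => // w Sw; apply: le_trans (mle w Sw).
rewrite leNgt; apply/negP => mv.
pose e := ip v v - m; have e0 : 0 < e by rewrite subr_gt0.
have v0 := rkhs_ip_ge0 hH Hv.
have e4 : 0 < e / 4 by rewrite divr_gt0.
have e16 : 0 < e ^+ 2 / (16 * (ip v v + 1)).
  by rewrite divr_gt0 ?exprn_gt0 // mulr_gt0 // ltr_wpDl.
have [N1 HN1] := small _ e4; have [N2 HN2] := uv _ e16.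
pose n := maxn N1 N2; have Hn := SH _ (Hu n).1.
have uvB := rkhs_sub Hn Hv.
have := HN1 n (leq_maxl _ _); have := HN2 n (leq_maxr _ _).
rewrite ltr_pdivlMr; last by rewrite mulr_gt0 // ltr_wpDl.
have := rkhs_cauchy_schwarz uvB Hv; rewrite rkhs_ipBl //.
have := rkhs_ip_ge0 hH uvB; move: (ip _ _) => D D0 cs De.
have := rkhs_ip_ge0 hH (rkhs_sub Hn Hv); rewrite rkhs_sqnormB // => uv0 ue.
have : (ip v v - ip (u n) v) ^+ 2 < (e / 4) ^+ 2.
  by rewrite -[_ ^+ 2]sqrrN opprB; nra.
move=> sq; have : ip v v - ip (u n) v < e / 4 by rewrite ltNge; apply/negP => h; nra.
by rewrite /e in ue *; lra.
Qed.

Section Derivatives.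
Hypothesis oOmega : open Omega.
Variables (y e : 'rV[R]_d).
Hypothesis Oy : Omega y.

Let Kf z := restr0 Omega (K ^~ z).

Lemma rkhs_ipK (z z' : 'rV[R]_d) : Omega z -> Omega z' -> ip (Kf z) (Kf z') = K z z'.
Proof.
move=> Oz Oz'; rewrite (rkhs_ip_sym hH (rkhs_kernel hH Oz) (rkhs_kernel hH Oz')).
rewrite -(rkhs_reproducing hH (rkhs_kernel hH Oz') Oz).
by rewrite /restr0 patchE mem_set.
Qed.

Let near_Omega : exists2 r : R, 0 < r & forall h : R, `|h| < r -> Omega (h *: e + y).
Proof.
have := open_near_line e oOmega Oy.
move=> /nbhs_normP[r /= r0 Hr]; exists r => // h hr; apply: Hr.
by rewrite /= sub0r normrN.
Qed.

Let quot h : 'rV[R]_d -> R := fun x => h^-1 * (Kf (h *: e + y) x - Kf y x).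

(** The inner product of two difference quotients of kernel sections is a mixed
    second difference quotient of the kernel. When these converge, the difference
    quotients of the sections form a Cauchy net, and by the reproducing property
    its limit represents the directional derivative at y. *)
Lemma rkhs_derivative (kappa : R) :
  (forall eps : R, 0 < eps -> exists2 del : R, 0 < del & forall h k : R,
    h != 0 -> k != 0 -> `|h| < del -> `|k| < del ->
    `|(K (h *: e + y) (k *: e + y) - K (h *: e + y) y - K y (k *: e + y) + K y y)
       / (h * k) - kappa| <= eps) ->
  exists2 g, H g & forall v, H v ->
    h^-1 * (v (h *: e + y) - v y) @[h --> 0^'] --> ip v g.
Proof.
move=> mixed; have [r r0 Or] := near_Omega.
have HK z : Omega z -> H (Kf z) by move=> Oz; exact: rkhs_kernel hH _ Oz.
have Hq h : `|h| < r -> H (quot h).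
  by move=> hr; apply/rkhs_scale/rkhs_sub; apply: HK => //; exact: Or.
have ipq h k : `|h| < r -> `|k| < r -> ip (quot h) (quot k) =
    (K (h *: e + y) (k *: e + y) - K (h *: e + y) y - K y (k *: e + y) + K y y)
       / (h * k).
  move=> hr kr; rewrite /quot.
  have Hh := rkhs_sub (HK _ (Or _ hr)) (HK _ Oy).
  have Hk := rkhs_sub (HK _ (Or _ kr)) (HK _ Oy).
  have [Oh Ok] := (Or _ hr, Or _ kr).
  rewrite (rkhs_ipZl _ Hh (rkhs_scale _ Hk)) (rkhs_ipZr _ Hk Hh).
  rewrite (rkhs_ipBl (HK _ Oh) (HK _ Oy) Hk).
  rewrite (rkhs_ipBr (HK _ Ok) (HK _ Oy) (HK _ Oh)).
  rewrite (rkhs_ipBr (HK _ Ok) (HK _ Oy) (HK _ Oy)) !rkhs_ipK //.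
  by rewrite invfM; ring.
have close (eps : R) : 0 < eps -> exists2 del : R, 0 < del <= r & forall h k : R,
    h != 0 -> k != 0 -> `|h| < del -> `|k| < del ->
    ip (fun x => quot h x - quot k x) (fun x => quot h x - quot k x) <= 4 * eps.
  move=> eps0; have [del del0 Hd] := mixed _ eps0.
  exists (Num.min r del); first by rewrite lt_min r0 del0 ge_min lexx.
  move=> h k h0 k0; rewrite !lt_min => /andP[hr hd] /andP[kr kd].
  rewrite (rkhs_sqnormB (Hq _ hr) (Hq _ kr)) !ipq //.
  have := Hd _ _ h0 h0 hd hd; have := Hd _ _ h0 k0 hd kd; have := Hd _ _ k0 k0 kd kd.
  by rewrite !ler_norml => /andP[? ?] /andP[? ?] /andP[? ?]; lra.
pose rho (n : nat) : R := r / n.+2%:R.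
have rho0 n : 0 < rho n by rewrite divr_gt0 // ltr0n.
have rhoE n : `|rho n| = rho n by rewrite gtr0_norm.
have rhor n : rho n < r by rewrite ltr_pdivrMr ?ltr0n // ltr_pMr // ltr1n.
have rhos del : 0 < del -> exists N, forall n, (N <= n)%N -> rho n < del.
  move=> del0; exists `|Num.ceil (r / del)|%N => n Nn.
  rewrite ltr_pdivrMr ?ltr0n // mulrC -ltr_pdivrMr //.
  apply: (@le_lt_trans _ _ `|Num.ceil (r / del)|%N%:R); last by rewrite ltr_nat; lia.
  rewrite natr_absz ger0_norm ?ceil_ge //.
  by rewrite ceil_ge0 (lt_trans (ltrN10 _)) // divr_gt0.
have Hqn n : H (quot (rho n)) by apply: Hq; rewrite rhoE.
have [eps eps0|g Hg gq] := rkhs_complete_sq Hqn.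
  have e8 : 0 < eps / 8 by rewrite divr_gt0.
  have [del /andP[del0 _] Hd] := close _ e8; have [N HN] := rhos _ del0.
  exists N => m n Nm Nn; apply: le_lt_trans (Hd _ _ _ _ _ _) _; rewrite ?rhoE ?gt_eqF ?HN //.
  by lra.
exists g => // v Hv; apply/cvgrPdist_le => eps eps0.
have v0 := rkhs_ip_ge0 hH Hv.
(* The 10 is 2 * 4 + 2, from the triangle inequality through the sequence rho. *)
pose eta := eps ^+ 2 / (10 * (ip v v + 1)).
have eta0 : 0 < eta by rewrite divr_gt0 ?exprn_gt0 // mulr_gt0 // ltr_wpDl.
have [del /andP[del0 delr] Hd] := close _ eta0; have [N1 HN1] := rhos _ del0.
have [N2 HN2] := gq _ eta0; pose n := maxn N1 N2.
have rd : rho n < del by apply: HN1; exact: leq_maxl.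
have gn := HN2 n (leq_maxr _ _).
near=> h.
have h0 : h != 0 by near: h; exact: nbhs_dnbhs_neq.
have hd : `|h| < del by near: h; exact: dnbhs0_lt.
have hr := lt_le_trans hd delr.
have E : ip v g - h^-1 * (v (h *: e + y) - v y) = ip v (fun x => g x - quot h x).
  rewrite (rkhs_ipBr Hg (Hq _ hr) Hv) /quot; congr (_ - _).
  have Oh := Or _ hr.
  rewrite (rkhs_ipZr _ (rkhs_sub (HK _ Oh) (HK _ Oy)) Hv).
  by rewrite (rkhs_ipBr (HK _ Oh) (HK _ Oy) Hv) -!(rkhs_reproducing hH).
have cs := rkhs_cauchy_schwarz Hv (rkhs_sub Hg (Hq _ hr)).
have tri := rkhs_sqnorm_triangle (Hq _ hr) (Hqn n) Hg.
have qq : ip (fun x => quot h x - quot (rho n) x) (fun x => quot h x - quot (rho n) x)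
   <= 4 * eta by apply: (Hd _ _ h0 (lt0r_neq0 (rho0 n)) hd); rewrite rhoE.
have sym : ip (fun x => g x - quot h x) (fun x => g x - quot h x) =
    ip (fun x => quot h x - g x) (fun x => quot h x - g x).
  rewrite (rkhs_sqnormB Hg (Hq _ hr)) (rkhs_sqnormB (Hq _ hr) Hg).
  by rewrite (rkhs_ip_sym hH Hg (Hq _ hr)); ring.
have bound : ip (fun x => g x - quot h x) (fun x => g x - quot h x) <= 10 * eta.
  by rewrite sym; lra.
have sq : ip v (fun x => g x - quot h x) ^+ 2 <= eps ^+ 2.
  apply: le_trans cs _; apply: (le_trans (ler_wpM2l v0 bound)).
  have -> : eps ^+ 2 = 10 * eta * (ip v v + 1).
    by rewrite /eta; field; rewrite gt_eqF // ltr_wpDl.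
  by rewrite mulrDr mulr1 mulrC lerDl mulr_ge0 // ltW.
rewrite E -[leRHS](gtr0_norm eps0) -(@ler_pXn2r _ 2) ?nnegrE //.
by rewrite -!normrX !ger0_norm ?sqr_ge0.
Unshelve. all: by end_near. Qed.

End Derivatives.
End RKHSTheory.

(** * Euclidean norm and radial kernels *)

Section EuclideanTheory.
Variables (R : realType) (d : nat).
Implicit Types (x y z u v : 'rV[R]_d) (a : R).

Lemma dotvC u v : dotv u v = dotv v u.
Proof. by apply: eq_bigr => j _; rewrite mulrC. Qed.

Lemma dotvDl u v z : dotv (u + v) z = dotv u z + dotv v z.
Proof. by rewrite -big_split; apply: eq_bigr => j _; rewrite mxE mulrDl. Qed.

Lemma dotvZl a u v : dotv (a *: u) v = a * dotv u v.
Proof. by rewrite mulr_sumr; apply: eq_bigr => j _; rewrite mxE mulrA. Qed.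

Lemma dotvDr u v z : dotv z (u + v) = dotv z u + dotv z v.
Proof. by rewrite !(dotvC z) dotvDl. Qed.

Lemma dotvZr a u v : dotv v (a *: u) = a * dotv v u.
Proof. by rewrite !(dotvC v) dotvZl. Qed.

Lemma dotv0 u : dotv u 0 = 0.
Proof. by apply: big1 => j _; rewrite mxE mulr0. Qed.

Lemma dotv_sumr (I : Type) (r : seq I) (P : pred I) (a : I -> R)
    (u : I -> 'rV[R]_d) v :
  dotv v (\sum_(i <- r | P i) a i *: u i) = \sum_(i <- r | P i) a i * dotv v (u i).
Proof.
elim/big_ind2: _ => [|x1 x2 y1 y2|i _]; first exact: dotv0.
- by rewrite dotvDr => -> ->.
- exact: dotvZr.
Qed.

Lemma dotv_sqrD x u : dotv (x + u) (x + u) = dotv x x + 2 * dotv x u + dotv u u.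
Proof. by rewrite dotvDl !dotvDr (dotvC u x); ring. Qed.

Lemma dotv_ge0 u : 0 <= dotv u u.
Proof. by apply: sumr_ge0 => j _; rewrite -expr2 sqr_ge0. Qed.

Lemma dotv_eq0 u : (dotv u u == 0) = (u == 0).
Proof.
apply/idP/eqP => [|->]; last by rewrite dotv0.
rewrite psumr_eq0 => [/allP u0|j _]; last by rewrite -expr2 sqr_ge0.
apply/rowP => j; have := u0 j; rewrite mem_index_enum => /(_ isT) /=.
by rewrite -expr2 sqrf_eq0 mxE => /eqP <-.
Qed.

Lemma enorm_ge0 u : 0 <= enorm u.
Proof. exact: sqrtr_ge0. Qed.

Lemma enorm_sqr u : enorm u ^+ 2 = dotv u u.
Proof. by rewrite sqr_sqrtr // dotv_ge0. Qed.

Lemma enormZ a u : enorm (a *: u) = `|a| * enorm u.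
Proof.
rewrite /enorm dotvZl dotvZr mulrA -expr2 sqrtrM ?sqr_ge0 //.
by rewrite sqrtr_sqr.
Qed.

Lemma enormN u : enorm (- u) = enorm u.
Proof. by rewrite -scaleN1r enormZ normrN1 mul1r. Qed.

Lemma enorm_gt0 u : (0 < enorm u) = (u != 0).
Proof. by rewrite sqrtr_gt0 lt_def dotv_ge0 dotv_eq0 andbT. Qed.

Lemma dotv_delta u j : dotv u (delta_mx ord0 j) = u ord0 j.
Proof.
rewrite /dotv (bigD1 j) //= big1 => [|i ij]; rewrite mxE !eqxx /=.
  by rewrite mulr1 addr0.
by rewrite (negbTE ij) mulr0.
Qed.

End EuclideanTheory.

Lemma between_dist (R : realType) (a b t : R) :
  Num.min a b <= t -> t <= Num.max a b -> `|b - t| <= `|b - a|.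
Proof.
by case: (leP a b) => ab t1 t2; [rewrite !ger0_norm|rewrite !ler0_norm]; lra.
Qed.

Section RadialKernel.
Variables (R : realType) (d : nat) (l k : nat) (c : R).
Hypotheses (lk : (0 < l + k)%N) (c0 : 0 < c).
Implicit Types (x y : 'rV[R]_d).

Let K x y : R := wendland l k.+1 (c * enorm (x - y)).

Lemma wendlandS_incr_sym (a b v e : R) : 0 <= a -> 0 <= b ->
  (forall t, Num.min a b <= t <= Num.max a b -> `|wendland l k t - v| <= e) ->
  `|wendland l k.+1 a - wendland l k.+1 b - (b ^+ 2 - a ^+ 2) / 2 * v|
    <= `|b ^+ 2 - a ^+ 2| / 2 * e.
Proof.
move=> a0 b0; case: (leP a b) => ab H.
  have ab2 : 0 <= b ^+ 2 - a ^+ 2 by nra.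
  by rewrite (ger0_norm ab2); exact: wendlandS_incr.
have ab2 : 0 <= a ^+ 2 - b ^+ 2 by nra.
rewrite -normrN [`|b ^+ 2 - _|]distrC (ger0_norm ab2).
have -> : - (wendland l k.+1 a - wendland l k.+1 b - (b ^+ 2 - a ^+ 2) / 2 * v) =
  wendland l k.+1 b - wendland l k.+1 a - (a ^+ 2 - b ^+ 2) / 2 * v by ring.
exact: wendlandS_incr lk b0 (ltW ab) H.
Qed.

(** By [wendlandS_incr] the second difference is c^2 h h' times a value of the
    k-th function near 0, up to a term in h'^2, which is harmless when
    |h'| <= |h|. *)
Lemma radial_mixed_difference y (j : 'I_d) : let e := delta_mx ord0 j in
  forall eps : R, 0 < eps -> exists2 del : R, 0 < del & forall h h' : R,
    h != 0 -> h' != 0 -> `|h| < del -> `|h'| < del ->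
    `|(K (h *: e + y) (h' *: e + y) - K (h *: e + y) y - K y (h' *: e + y) + K y y)
       / (h * h') - c ^+ 2 * wendland l k 0| <= eps.
Proof.
move=> e eps eps0; pose v : R := wendland l k 0.
have [eta eta0 Heta] : exists2 eta : R, 0 < eta & forall t : R, 0 <= t < eta ->
    `|wendland l k t - v| <= eps / (2 * c ^+ 2).
  have e0 : 0 < eps / (2 * c ^+ 2) by rewrite divr_gt0 // mulr_gt0 // exprn_gt0.
  have /cvgrPdist_le/(_ _ e0)/nbhs_normP[eta /= eta0 H] := @continuous_wendland R l k 0.
  exists eta => // t /andP[t0 te]; rewrite distrC; apply: H.
  by rewrite /= sub0r normrN ger0_norm.
exists (eta / (2 * c)); first by rewrite divr_gt0 // mulr_gt0.
have KE h h' : K (h *: e + y) (h' *: e + y) = wendland l k.+1 (c * `|h - h'|).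
  by rewrite /K opprD addrACA subrr addr0 -scalerBl enormZ /enorm dotv_delta mxE !eqxx sqrtr1 mulr1.
have KE0 h : K (h *: e + y) y = wendland l k.+1 (c * `|h|).
  by have := KE h 0; rewrite scale0r add0r subr0.
have KE0' h : K y (h *: e + y) = wendland l k.+1 (c * `|h|).
  by have := KE 0 h; rewrite scale0r add0r sub0r normrN.
have KE00 : K y y = wendland l k.+1 0.
  by have := KE 0 0; rewrite scale0r add0r subrr normr0 mulr0.
move=> h h' h0 h'0; rewrite !ltr_pdivlMr ?mulr_gt0 // => hd hd'.
rewrite KE KE0 KE0' KE00.
(* The expression is symmetric in h and h'. *)
wlog hh : h h' h0 h'0 hd hd' / `|h'| <= `|h|.
  move=> W; have [|/ltW] := leP `|h'| `|h|; first exact: W.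
  move=> /(W _ _ h'0 h0 hd' hd); rewrite [`|h' - h|]distrC (mulrC h').
  by rewrite (addrAC _ (- wendland l k.+1 (c * `|h'|))).
have hhd : `|h - h'| <= `|h| + `|h'| by exact: ler_normB.
have [n0 n0'] := (normr_ge0 h, normr_ge0 h').
have ch' : 0 <= c * `|h'| by rewrite mulr_ge0 // ltW.
have small t : 0 <= t <= c * `|h| + c * `|h'| -> `|wendland l k t - v| <= eps / (2 * c ^+ 2).
  by move=> /andP[t0 th]; apply: Heta; rewrite t0 /=; nra.
have I1 : `|wendland l k.+1 (c * `|h - h'|) - wendland l k.+1 (c * `|h|) -
    ((c * `|h|) ^+ 2 - (c * `|h - h'|) ^+ 2) / 2 * v| <=
    `|(c * `|h|) ^+ 2 - (c * `|h - h'|) ^+ 2| / 2 * (eps / (2 * c ^+ 2)).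
  apply: wendlandS_incr_sym; rewrite ?mulr_ge0 // ?(ltW c0) // => t /andP[].
  rewrite le_max => t1 t2; apply: small; apply/andP; split.
    by apply: le_trans t1; rewrite le_min !mulr_ge0 // ltW.
  case/orP: t2 => t2; apply: le_trans t2 _; last by rewrite lerDl.
  by rewrite -mulrDr ler_wpM2l // ltW.
have I2 : `|wendland l k.+1 0 - wendland l k.+1 (c * `|h'|) -
    ((c * `|h'|) ^+ 2 - 0 ^+ 2) / 2 * v| <=
    `|(c * `|h'|) ^+ 2 - 0 ^+ 2| / 2 * (eps / (2 * c ^+ 2)).
  apply: wendlandS_incr_sym => [//||t]; first by rewrite mulr_ge0 // ltW.
  rewrite min_l ?max_r ?mulr_ge0 ?(ltW c0) // => /andP[t1 t2]; apply: small.
  by rewrite t1 (le_trans t2) // lerDr mulr_ge0 // ltW.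
rewrite !exprMn !real_normK ?num_real // in I1 I2.
set w0 := wendland l k.+1 0 in I2 *; set wh := wendland l k.+1 (c * `|h|) in I1 *.
set wh' := wendland l k.+1 (c * `|h'|) in I2 *.
set wd := wendland l k.+1 _ in I1 *.
have hh'0 : h * h' != 0 by rewrite mulf_neq0.
have -> : (wd - wh - wh' + w0) / (h * h') - c ^+ 2 * v =
   (wd - wh - (c ^+ 2 * h ^+ 2 - c ^+ 2 * (h - h') ^+ 2) / 2 * v +
    (w0 - wh' - (c ^+ 2 * h' ^+ 2 - 0 ^+ 2) / 2 * v)) / (h * h').
  by field; rewrite h0 h'0.
rewrite normrM normfV ler_pdivrMr ?normr_gt0 // (le_trans (ler_normD _ _)) //.
apply: (le_trans (lerD I1 I2)).
have -> : c ^+ 2 * h ^+ 2 - c ^+ 2 * (h - h') ^+ 2 = c ^+ 2 * (2 * (h * h') - h' ^+ 2).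
  by ring.
have c2 : 0 <= c ^+ 2 by exact: sqr_ge0.
have ch2 : 0 <= c ^+ 2 * h' ^+ 2 by apply: mulr_ge0; exact: sqr_ge0.
rewrite expr0n subr0 (ger0_norm ch2).
rewrite normrM (ger0_norm c2).
have T : `|2 * (h * h') - h' ^+ 2| <= 2 * (`|h| * `|h'|) + `|h'| ^+ 2.
  apply: le_trans (ler_normB _ _) _.
  by rewrite (normrM 2) (normrM h) (ger0_norm (ler0n _ 2)) normrX.
set B := `|2 * (h * h') - h' ^+ 2| in T *.
have -> : c ^+ 2 * B / 2 * (eps / (2 * c ^+ 2)) + c ^+ 2 * h' ^+ 2 / 2 * (eps / (2 * c ^+ 2))
   = eps * ((B + `|h'| ^+ 2) / 4).
  by rewrite real_normK ?num_real //; field; rewrite gt_eqF.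
rewrite ler_wpM2l ?(ltW eps0) // normrM.
nra.
Qed.

(** The increment lemma in terms of squared distances avoids the singularity of
    the norm at x = y. *)
Lemma radial_derivative x y (j : 'I_d) : let e := delta_mx ord0 j in
  h^-1 * (K x (h *: e + y) - K x y) @[h --> 0^'] -->
    c ^+ 2 * wendland l k (c * enorm (x - y)) * (x - y) ord0 j.
Proof.
move=> e; pose b := c * enorm (x - y); pose v := wendland l k b.
pose a h := c * enorm (x - (h *: e + y)).
have b0 : 0 <= b by rewrite mulr_ge0 ?enorm_ge0 // ltW.
have a0 h : 0 <= a h by rewrite mulr_ge0 ?enorm_ge0 // ltW.
pose p := (x - y) ord0 j.
have aE h : a h ^+ 2 = b ^+ 2 + c ^+ 2 * (h ^+ 2 - 2 * h * p).
  have E : x - (h *: e + y) = (x - y) + (- h) *: e.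
    by rewrite scaleNr opprD [- (h *: e) - y]addrC addrA.
  rewrite /a /b E !exprMn !enorm_sqr dotv_sqrD dotvZr dotv_delta dotvZl dotvZr.
  by rewrite dotv_delta [delta_mx _ _ _ _]mxE !eqxx -/p /=; ring.
pose q : {poly R} := (b ^+ 2)%:P + c ^+ 2 *: ('X^2 - (2 * p) *: 'X).
have qE h : q.[h] = a h ^+ 2.
  by rewrite aE /q !(hornerD, hornerC, hornerZ, hornerN, hornerXn, hornerX); ring.
have acont : a h @[h --> 0] --> b.
  have -> : a = Num.sqrt \o horner q.
    by apply/funext => h /=; rewrite qE sqrtr_sqr ger0_norm.
  have <- : Num.sqrt q.[0] = b.
    by rewrite qE aE expr0n mulr0 mul0r subr0 mulr0 addr0 sqrtr_sqr ger0_norm.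
  exact: cvg_comp (@continuous_horner _ q 0) (@sqrt_continuous _ q.[0]).
apply/cvgrPdist_le => eps eps0; pose D := c ^+ 2 * (2 * `|p| + 1).
have D0 : 0 < D by rewrite mulr_gt0 ?exprn_gt0 // ltr_wpDl // mulr_ge0.
have V0 : 0 < c ^+ 2 * (`|v| + 1) by rewrite mulr_gt0 ?exprn_gt0 // ltr_wpDl.
have [eta eta0 Heta] : exists2 eta : R, 0 < eta & forall t, `|b - t| < eta ->
    `|wendland l k t - v| <= eps / D.
  have e0 : 0 < eps / D by rewrite divr_gt0.
  have /cvgrPdist_le/(_ _ e0)/nbhs_normP[eta /= eta0 H] := @continuous_wendland R l k b.
  by exists eta => // t tb; rewrite distrC; apply: H.
near=> h.
have h0 : h != 0 by near: h; exact: nbhs_dnbhs_neq.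
have h1 : `|h| <= 1 by apply/ltW; near: h; exact: dnbhs0_lt.
have hv : `|h| <= eps / (c ^+ 2 * (`|v| + 1)).
  by apply/ltW; near: h; apply: dnbhs0_lt; exact: divr_gt0.
have ab : `|b - a h| < eta.
  near: h; apply: cvg_within.
  by move/cvgrPdist_lt: acont; apply.
have I : `|wendland l k.+1 (a h) - wendland l k.+1 b - (b ^+ 2 - a h ^+ 2) / 2 * v|
    <= `|b ^+ 2 - a h ^+ 2| / 2 * (eps / D).
  apply: wendlandS_incr_sym => // t /andP[t1 t2]; apply: Heta; apply: le_lt_trans ab.
  exact: between_dist.
have {I} I : `|wendland l k.+1 (a h) - wendland l k.+1 b -
    c ^+ 2 * (h * (2 * p - h)) / 2 * v| <= `|c ^+ 2 * (h * (2 * p - h))| / 2 * (eps / D).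
  have E : b ^+ 2 - a h ^+ 2 = c ^+ 2 * (h * (2 * p - h)) by rewrite aE; ring.
  by rewrite E in I.
have alg (Wa Wb v' : R) : c ^+ 2 * v' * p - h^-1 * (Wa - Wb) =
    - (h^-1 * (Wa - Wb - c ^+ 2 * (h * (2 * p - h)) / 2 * v') - c ^+ 2 * h * v' / 2).
  by field.
rewrite /K -/b -/(a h) -/v -/p alg.
rewrite normrN (le_trans (ler_normB _ _)) //.
have T1 : `|c ^+ 2 * h * v / 2| <= eps / 2.
  rewrite (normrM (c ^+ 2 * h * v)) (normrM (c ^+ 2 * h)) (normrM (c ^+ 2)).
  rewrite (ger0_norm (sqr_ge0 c)) (ger0_norm (_ : 0 <= 2^-1)) // ler_wpM2r //.
  move: hv; rewrite ler_pdivlMr //; have := normr_ge0 h; have := normr_ge0 v.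
  by have := sqr_ge0 c; nra.
have T2 : `|h^-1 * (wendland l k.+1 (a h) - wendland l k.+1 b -
     c ^+ 2 * (h * (2 * p - h)) / 2 * v)| <= eps / 2.
  have hn0 : 0 < `|h| by rewrite normr_gt0.
  rewrite normrM normfV mulrC ler_pdivrMr //; apply: le_trans I _.
  rewrite (normrM (c ^+ 2)) (ger0_norm (sqr_ge0 c)) normrM.
  have pD : c ^+ 2 * `|2 * p - h| <= D.
    rewrite ler_wpM2l ?sqr_ge0 // (le_trans (ler_normB _ _)) // lerD //.
    by rewrite normrM ger0_norm.
  have -> : c ^+ 2 * (`|h| * `|2 * p - h|) / 2 * (eps / D) =
      c ^+ 2 * `|2 * p - h| * (`|h| * (eps / D) / 2) by ring.
  have -> : eps / 2 * `|h| = D * (`|h| * (eps / D) / 2) by field; rewrite gt_eqF.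
  apply: ler_wpM2r pD; apply: divr_ge0 => //; apply: mulr_ge0 => //.
  by apply: divr_ge0; exact: ltW.
by rewrite (splitr eps) lerD.
Unshelve. all: by end_near. Qed.

End RadialKernel.

(** * Representers of gradients *)

Section WendlandRepresenters.
Variables (R : realType) (d k : nat) (Omega : set 'rV[R]_d) (c : R).
Variables (H : set ('rV[R]_d -> R)).
Variable ip : ('rV[R]_d -> R) -> ('rV[R]_d -> R) -> R.
Hypotheses (hH : is_RKHS Omega (@Phi R d k.+1 c) H ip) (oOmega : open Omega).
Hypothesis c0 : 0 < c.

Let l := (d./2 + k.+1 + 1)%N.
Let lk : (0 < l + k)%N. Proof. by rewrite /l addn1. Qed.

Lemma PhiE x y : @Phi R d k.+1 c x y = wendland l k.+1 (c * enorm (x - y)).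
Proof. by []. Qed.

Lemma PhiC x y : @Phi R d k.+1 c x y = Phi k.+1 c y x.
Proof. by rewrite !PhiE -enormN opprB. Qed.

Lemma sectionE x z : Omega z ->
  restr0 Omega (@Phi R d k.+1 c ^~ x) z = Phi k.+1 c x z.
Proof. by move=> Oz; rewrite /restr0 patchE (mem_set Oz) PhiC. Qed.

Lemma derive_cvg (v : 'rV[R]_d -> R) (y e : 'rV[R]_d) (a : R) :
  h^-1 * (v (h *: e + y) - v y) @[h --> 0^'] --> a -> 'D_e v y = a.
Proof. by move=> va; apply/cvg_lim. Qed.

Lemma dotv_grad_Phi x y w : dotv (grad (@Phi R d k.+1 c x) y) w =
  c ^+ 2 * wendland l k (c * enorm (x - y)) * dotv (x - y) w.
Proof.
rewrite /dotv mulr_sumr; apply: eq_bigr => j _; rewrite mxE mulrA; congr (_ * _).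
exact/derive_cvg/radial_derivative.
Qed.

(** The representer given by [rkhs_derivative] is identified pointwise: its value
    at x is its inner product with the section of the kernel at x, hence the
    derivative of that section. *)
Lemma wendland_gradient_riesz y w : Omega y ->
  let G := restr0 Omega
    (fun x => c ^+ 2 * wendland l k (c * enorm (x - y)) * dotv (x - y) w) in
  H G /\ forall v, H v -> dotv (grad v y) w = ip v G.
Proof.
move=> Oy G.
have gex (j : 'I_d) : exists g, H g /\ forall v, H v ->
    h^-1 * (v (h *: delta_mx ord0 j + y) - v y) @[h --> 0^'] --> ip v g.
  have [g Hg gd] := rkhs_derivative hH oOmega Oy (radial_mixed_difference lk c0 y j).
  by exists g.
have [g Hg] := choice gex.
have GE : G = fun x => \sum_j w ord0 j * g j x.
  apply/funext => x; rewrite /G /restr0 patchE; case: ifPn => [/set_mem Ox|/negP xO].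
    rewrite /dotv mulr_sumr; apply: eq_bigr => j _; rewrite mulrA mulrC; congr (_ * _).
    rewrite (rkhs_reproducing hH (Hg j).1 Ox).
    have HK := rkhs_kernel hH Ox; rewrite (rkhs_ip_sym hH (Hg j).1 HK).
    apply: (@cvg_unique _ (@Rhausdorff R)) ((Hg j).2 _ HK).
    have near_Omega := open_near_line (delta_mx ord0 j) oOmega Oy.
    apply: cvg_trans (@radial_derivative R d l k c lk c0 x y j).
    apply: near_eq_cvg; apply: cvg_within; near=> h.
    have Oh : Omega (h *: delta_mx ord0 j + y) by near: h.
    by rewrite (sectionE x Oh) (sectionE x Oy) !PhiE.
  have z j : g j x = 0.
    have := congr1 (fun v => v x) (rkhs_on hH (Hg j).1).
    by rewrite /restr0 patchE ifN //; apply/negP.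
  by rewrite big1 // => j _; rewrite z mulr0.
have Hgj j : true -> H (g j) by move=> _; exact: (Hg j).1.
split; first by rewrite GE; apply: (rkhs_sum hH) => j _; exact: (Hg j).1.
move=> v Hv; rewrite GE (rkhs_ip_sumr hH _ _ Hgj Hv); apply: eq_bigr => j _.
by rewrite mxE mulrC; congr (_ * _); apply: derive_cvg; exact: (Hg j).2.
Unshelve. all: by end_near. Qed.

End WendlandRepresenters.

(** * Linear independence of kernel gradients *)

Section TruncatedPowers.
Variable R : realType.

Lemma poly_divXn (p : {poly R}) n : (forall i, (i < n)%N -> p`_i = 0) ->
  exists q, p = 'X^n * q /\ q.[0] = p`_n.
Proof.
move=> p0; exists (drop_poly n p); split; last first.
  by rewrite horner_coef0 coef_drop_poly add0n.
rewrite -{1}(poly_take_drop n p) mulrC; suff -> : take_poly n p = 0 by rewrite add0r.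
by apply/polyP => i; rewrite coef_take_poly coef0; case: ifP => // /p0.
Qed.

(** When tau < 0 the function s_+ is replaced by (-s)_+; since
    s_+^n + (-1)^n (-s)_+^n = s^n, this changes the jump at most by a sign. *)
Lemma has_jump_horner_max n (p : {poly R}) (tau : R) : (0 < n)%N ->
  (forall i, (i < n)%N -> p`_i = 0) ->
  exists2 J, `|J| = `|p`_n| * `|tau| ^+ n &
    has_jump n (fun s => p.[Num.max 0 (tau * s)]) J.
Proof.
move=> n0 p0; have [q [pE qn]] := poly_divXn p0.
have [q' q'E] := poly_split_const q; have [B B0 qB] := horner_bounded q'.
have [J0 J0n m_jump] : exists2 J0, `|J0| = `|tau| ^+ n &
    has_jump n (fun s => Num.max 0 (tau * s) ^+ n) J0.
  have [t0|t0] := leP 0 tau.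
    exists (tau ^+ n); first by rewrite normrX.
    rewrite -[tau ^+ n]mulr1; apply: eq_near_jump (has_jumpZ _ (@has_jump_max R n)).
    by near=> s; rewrite -exprMn maxr_pMr ?mulr0.
  exists (- tau ^+ n); first by rewrite normrN normrX.
  have := has_jumpD (has_jump_horner n (tau ^+ n *: 'X^n))
    (has_jumpZ (- tau ^+ n) (@has_jump_max R n)).
  rewrite add0r mulr1; apply: eq_near_jump; near=> s.
  rewrite hornerZ hornerXn; case: (leP 0 s) => s0.
    by rewrite max_l ?nmulr_rle0 // expr0n gtn_eqF // mulNr subrr.
  rewrite max_r; last by rewrite nmulr_rge0 // ltW.
  by rewrite expr0n gtn_eqF // mulr0 addr0 exprMn.
exists (p`_n * J0); first by rewrite normrM J0n.
have rem : has_jump n (fun s => Num.max 0 (tau * s) ^+ n.+1 * q'.[Num.max 0 (tau * s)]) 0.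
  apply: (@has_jump_big_O _ _ _ (`|tau| ^+ n.+1 * B)); near=> s.
  have ms : `|Num.max 0 (tau * s)| <= `|tau| * `|s|.
    by rewrite -normrM; case: (leP 0 (tau * s)) => // _; rewrite normr0.
  have s1 : `|tau * s| <= 1.
    have t1 : 0 < `|tau| + 1 by rewrite ltr_wpDl.
    have : `|s| < 1 / (`|tau| + 1) by near: s; apply: near0_lt; rewrite divr_gt0.
    by rewrite normrM ltr_pdivlMr // => s1; have := normr_ge0 s; nra.
  rewrite normrM mulrAC normrX -exprMn ler_pM ?exprn_ge0 //.
    by rewrite lerXn2r ?nnegrE ?mulr_ge0.
  by apply: qB; rewrite (le_trans ms) // -normrM.
have := has_jumpD (has_jumpZ p`_n m_jump) rem; rewrite addr0.
apply: eq_near_jump; near=> s.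
by rewrite pE hornerM hornerXn {2}q'E hornerD hornerC hornerM hornerX qn exprS -pE; ring.
Unshelve. all: by end_near. Qed.

End TruncatedPowers.

Section GradientsFree.
Variables (R : realType) (d k : nat) (c : R).
Hypothesis c0 : 0 < c.
Implicit Types (x y u v w : 'rV[R]_d).

Let l := (d./2 + k.+1 + 1)%N.
Let n := k.*2.+2.
Let lk : (0 < l + k)%N. Proof. by rewrite /l addn1. Qed.
Let n0 : (0 < n)%N. Proof. by []. Qed.

(** Up to the factor c^2, this is the gradient of the kernel of index k+1 with
    centre displaced by - v from the base point, along a line of direction u,
    paired with the weight w; its profile has index k. *)
Let term v u w : R -> R :=
  fun s => wendland l k (c * enorm (v + s *: u)) * dotv (v + s *: u) w.

(** At its own centre the profile has the singular part |s|^(2k+1), which after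
    multiplication by s jumps at order 2k+2. *)
Lemma has_jump_centre u :
  has_jump n (term 0 u u)
    (dotv u u * (2 * (wendX R l k)`_(k.*2.+1) * (c * enorm u) ^+ k.*2.+1)).
Proof.
have a0 : 0 <= c * enorm u by rewrite mulr_ge0 ?enorm_ge0 // ltW.
have odd_ : odd k.*2.+1 by rewrite /= odd_double.
have coef0 i : odd i -> (i < k.*2.+1)%N -> (wendX R l k)`_i = 0.
  exact: coef_wendX_odd.
have := has_jump_shift (ltn0Sn _)
  (has_jumpZ (dotv u u) (has_jump_horner_norm odd_ coef0 a0)).
apply: eq_near_jump; near=> s.
rewrite /term add0r dotvZl enormZ wendland_le1; last first.
  have : `|s| < 1 / (c * enorm u + 1).
    by near: s; apply: near0_lt; rewrite divr_gt0 // ltr_wpDl.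
  rewrite ltr_pdivlMr ?ltr_wpDl // mulrDr mulr1 mulrCA => s1.
  by have := normr_ge0 s; lra.
have -> : c * (`|s| * enorm u) = c * enorm u * `|s| by ring.
by ring.
Unshelve. all: by end_near. Qed.

Section OtherCentres.
Variables (v u w : 'rV[R]_d).

Let q : {poly R} :=
  (dotv v v)%:P + (2 * dotv v u) *: 'X + (dotv u u) *: 'X^2.

Let qE s : q.[s] = dotv (v + s *: u) (v + s *: u).
Proof.
rewrite /q !(hornerD, hornerC, hornerZ, hornerXn, hornerX).
by rewrite dotv_sqrD dotvZr dotvZl dotvZr; ring.
Qed.

Let enormE s : enorm (v + s *: u) = Num.sqrt q.[s].
Proof. by rewrite qE. Qed.

Let L : {poly R} := (dotv v w)%:P + (dotv u w) *: 'X.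

Let LE s : L.[s] = dotv (v + s *: u) w.
Proof. by rewrite /L !(hornerD, hornerC, hornerZ, hornerX) dotvDl dotvZl mulrC. Qed.

Let has_jump_term J : has_jump n (fun s => wendland l k (c * enorm (v + s *: u))) J ->
  has_jump n (term v u w) (J * dotv v w).
Proof.
move=> WJ; have := has_jumpM n0 WJ (has_jump_horner n L).
rewrite mul0r addr0 (_ : L.[0] = dotv v w); last by rewrite LE scale0r addr0.
by apply: eq_near_jump; near=> s; rewrite LE.
Unshelve. all: by end_near. Qed.

Let cvg_enorm : c * enorm (v + s *: u) @[s --> (0 : R)] --> c * enorm v.
Proof.
rewrite (_ : (fun s : R => c * enorm (v + s *: u)) =
  (fun s : R => c * (Num.sqrt \o horner q) s)); last first.
  by apply/funext => s; rewrite enormE.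
have -> : enorm v = Num.sqrt q.[0] by rewrite qE scale0r addr0.
apply: cvgM; first exact: cvg_cst.
exact: cvg_comp (@continuous_horner _ q 0) (@sqrt_continuous _ q.[0]).
Qed.

(** Off its centre the kernel is smooth, except on the boundary of its
    support. The norm is the square root of a polynomial in s that is positive
    at 0. *)
Lemma has_jump_off_sphere : v != 0 -> c * enorm v != 1 ->
  has_jump n (term v u w) 0.
Proof.
move=> v0; rewrite neq_lt => /orP[v1|v1]; rewrite -(mul0r (dotv v w)).
  apply: has_jump_term.
  have q0 : 0 < q.[0] by rewrite qE scale0r addr0 lt_def dotv_eq0 v0 dotv_ge0.
  have := has_jump_horner_comp (wendX R l k \Po (c *: 'X)) n0 (has_jump_sqrt n q0).
  apply: eq_near_jump; near=> s.
  rewrite horner_comp hornerZ hornerX -enormE wendland_le1 //.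
  by apply/ltW; near: s; exact: cvgr_lt cvg_enorm _ v1.
apply: has_jump_term; apply: eq_near_jump (has_jump_horner n 0); near=> s.
rewrite horner0 wendland_ge1 //.
by apply/ltW; near: s; exact: cvgr_gt cvg_enorm _ v1.
Unshelve. all: by end_near. Qed.

(** On the boundary of the support the profile vanishes to order l+k, which in
    dimension at least 2 exceeds 2k+2. *)
Lemma has_jump_on_sphere : (1 < d)%N -> c * enorm v = 1 ->
  has_jump n (term v u w) 0.
Proof.
move=> d1 v1; rewrite -(mul0r (dotv v w)); apply: has_jump_term.
have nl : (n.+1 <= l + k)%N by rewrite /n /l; lia.
have [p [pE _]] : exists p, wendY R l k = 'X^(n.+1) * p /\ p.[0] = (wendY R l k)`_n.+1.
  by apply: poly_divXn => i iN; apply: coef_wendY_small; exact: leq_trans nl.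
have [B B0 pB] := horner_bounded p.
pose D := c ^+ 2 * (2 * `|dotv v u| + dotv u u).
have D0 : 0 <= D by rewrite mulr_ge0 ?sqr_ge0 // addr_ge0 ?dotv_ge0 ?mulr_ge0.
apply: (@has_jump_big_O _ _ _ (D ^+ n.+1 * B)); near=> s.
have s1 : `|s| <= 1 by apply/ltW; near: s; exact: near0_lt.
have sD : `|s| < 1 / (D + 1).
  by near: s; apply: near0_lt; rewrite divr_gt0 // ltr_wpDl.
pose r := c * enorm (v + s *: u); have r0 : 0 <= r.
  by rewrite mulr_ge0 ?enorm_ge0 // ltW.
have r1 : `|1 - r| <= D * `|s|.
  have r2 : r ^+ 2 = 1 + c ^+ 2 * (2 * dotv v u * s + dotv u u * s ^+ 2).
    rewrite /r exprMn enorm_sqr dotv_sqrD dotvZr dotvZl dotvZr.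
    by rewrite -(expr1n _ 2) -v1 exprMn enorm_sqr; ring.
  have -> : D * `|s| = c ^+ 2 * (2 * `|dotv v u| * `|s| + dotv u u * `|s|) by rewrite /D; ring.
  apply: (@le_trans _ _ `|1 - r ^+ 2|).
    rewrite -[1 - r ^+ 2]/(1 - r ^+ 2) -{2}(expr1n _ 2) subr_sqr normrM ler_peMr //.
    by rewrite ger0_norm; lra.
  rewrite r2 opprD addNKr normrN normrM (ger0_norm (sqr_ge0 c)) ler_wpM2l ?sqr_ge0 //.
  apply: le_trans (ler_normD _ _) _; apply: lerD; first by rewrite !normrM ger0_norm.
  rewrite normrM (ger0_norm (dotv_ge0 u)) ler_wpM2l ?dotv_ge0 // normrX expr2.
  by rewrite ler_piMr.
have m1 : `|Num.max 0 (1 - r)| <= D * `|s|.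
  by case: (leP 0 (1 - r)) => // _; rewrite normr0 mulr_ge0.
rewrite -/r wendlandE pE hornerM hornerXn normrM mulrAC normrX -exprMn.
apply: ler_pM => //.
  by apply: lerXn2r m1; rewrite nnegrE // mulr_ge0.
apply: pB; apply: le_trans m1 _; move: sD.
rewrite ltr_pdivlMr ?ltr_wpDl // => sD; have := normr_ge0 s; nra.
Unshelve. all: by end_near. Qed.

Let dotv_dim1 x y : d = 1%N -> `|dotv x y| = enorm x * enorm y.
Proof.
by move=> d1; subst d; rewrite /enorm /dotv !big_ord1 normrM -!expr2 !sqrtr_sqr.
Qed.

(** In dimension 1 the order l+k equals 2k+2 and the boundary of the support
    does contribute. *)
Lemma has_jump_on_sphere_dim1 : d = 1%N -> c * enorm v = 1 ->
  exists2 J, `|J| = (wendY R l k)`_(l + k) * (c * enorm u) ^+ n * (enorm w / c) &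
    has_jump n (term v u w) J.
Proof.
move=> d1 v1; have vE : enorm v = c^-1.
  by apply: (mulfI (lt0r_neq0 c0)); rewrite v1 divff // gt_eqF.
have v0 : 0 < enorm v by rewrite vE invr_gt0.
have lkn : (l + k)%N = n by rewrite /l /n d1; lia.
have Y0 i : (i < n)%N -> (wendY R l k)`_i = 0.
  by rewrite -lkn; exact: coef_wendY_small.
have Yn0 := ltW (coef_wendY_gt0 R l k).
pose a := dotv v u / enorm v.
have aE : `|a| = enorm u.
  by rewrite normrM dotv_dim1 // normfV (gtr0_norm v0) mulrAC mulfV ?mul1r // gt_eqF.
have [J JE WJ] := has_jump_horner_max (- c * a) n0 Y0.
exists (J * dotv v w).
  rewrite normrM JE dotv_dim1 // normrM normrN (gtr0_norm c0) aE vE -[in `|_|]lkn (ger0_norm Yn0).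
  by rewrite [c^-1 * _]mulrC.
apply: has_jump_term; apply: eq_near_jump WJ; near=> s.
have sa : 0 <= enorm v + a * s.
  have : `|s| < enorm v / (`|a| + 1).
    by near: s; apply: near0_lt; rewrite divr_gt0 // ltr_wpDl.
  rewrite ltr_pdivlMr ?ltr_wpDl // => h.
  by have := ler_norm (- (a * s)); rewrite normrN normrM; have := normr_ge0 s; lra.
have -> : enorm (v + s *: u) = enorm v + a * s.
  rewrite -[RHS]ger0_norm // -sqrtr_sqr; congr Num.sqrt.
  rewrite dotv_sqrD dotvZr dotvZl dotvZr -(enorm_sqr v) -(enorm_sqr u) -aE.
  by rewrite real_normK ?num_real // /a; field; rewrite gt_eqF.
rewrite wendlandE; congr (_.[Num.max 0 _]).
by rewrite mulrDr v1; ring.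
Unshelve. all: by end_near. Qed.

End OtherCentres.

(** Near the centre with the largest weight w t, in the direction w t, the jump
    of order 2k+2 produced by that centre must be compensated by centres at
    distance exactly 1/c. These contribute nothing in dimension at least 2; in
    dimension 1 there are at most two of them, and each one is too weak to cancel
    half of the jump. *)
Theorem kernel_gradients_free (Omega : set 'rV[R]_d) (T : finType)
    (y w : T -> 'rV[R]_d) : open Omega -> (forall t, Omega (y t)) ->
  injective y ->
  (forall x, Omega x -> \sum_t wendland l k (c * enorm (x - y t)) *
     dotv (x - y t) (w t) = 0) ->
  forall t, w t = 0.
Proof.
move=> oOmega Oy yinj sum0 t1; apply/eqP; apply: contraT => wt1.
have [t _ tmax] := @arg_maxP _ _ T t1 xpredT (fun t => enorm (w t)) isT.
set u := w t in tmax; have u0 : 0 < enorm u.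
  by apply: lt_le_trans (tmax t1 isT); rewrite enorm_gt0.
pose B := (wendY R l k)`_(l + k) * (c * enorm u) ^+ n * (enorm u / c).
pose rival t' := (t' != t) && ((d == 1%N) && (c * enorm (y t - y t') == 1)).
have Y0 := coef_wendY_gt0 R l k.
have cu : 0 < c * enorm u by exact: mulr_gt0.
pose J0 := dotv u u * (2 * (wendX R l k)`_(k.*2.+1) * (c * enorm u) ^+ k.*2.+1).
have jumps t' : exists J, has_jump n (term (y t - y t') u (w t')) J /\
    (t' = t -> J = J0) /\ (t' != t -> `|J| <= if rival t' then B else 0).
  have [->|t't] := eqVneq t' t.
    by exists J0; rewrite subrr; split; [exact: has_jump_centre|].
  have yt : y t - y t' != 0.
    by rewrite subr_eq0 eq_sym; apply: contra t't => /eqP/yinj ->.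
  have [y1|y1] := eqVneq (c * enorm (y t - y t')) 1; last first.
    exists 0; split; first exact: has_jump_off_sphere.
    split=> [/eqP|_]; first by rewrite (negbTE t't).
    by rewrite /rival (negbTE y1) !andbF normr0.
  have [d1|d1] := eqVneq d 1%N; last first.
    exists 0; split.
      apply: has_jump_on_sphere => //; rewrite ltn_neqAle eq_sym d1 /=.
      by rewrite lt0n; apply: contraNneq yt => d0; apply/eqP/rowP => -[i id0]; lia.
    split=> [/eqP|_]; first by rewrite (negbTE t't).
    by rewrite /rival (negbTE d1) !andbF normr0.
  have [J JE WJ] := has_jump_on_sphere_dim1 u (w t') d1 y1.
  exists J; split=> //; split=> [/eqP|_]; first by rewrite (negbTE t't).
  have -> : rival t' by rewrite /rival t't y1 eqxx andbT; apply/eqP.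
  rewrite JE /B ler_wpM2l //.
    by rewrite mulr_ge0 ?exprn_ge0 // ltW.
  by rewrite ler_pM2r ?invr_gt0 //; exact: tmax.
have [J HJ] := choice jumps.
have J_sum : \sum_t' J t' = 0.
  apply: (@has_jump_unique0 R n) => //.
  have := @has_jump_sum R n T (index_enum T) xpredT _ J (fun t' _ => (HJ t').1).
  apply: eq_near_jump.
  have near_Omega := open_near_line u oOmega (Oy t).
  near=> s; rewrite -[RHS](sum0 (y t + s *: u)); last by rewrite addrC; near: s.
  by apply: eq_bigr => t' _; rewrite /term addrAC.
have J0_le : `|J0| <= \sum_(t' | rival t') B.
  move: J_sum; rewrite (bigD1 t) //= (HJ t).2.1 // => /eqP; rewrite addr_eq0 => /eqP ->.
  rewrite normrN (le_trans (ler_norm_sum _ _ _)) // big_mkcond [leRHS]big_mkcond.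
  apply: ler_sum => t' _; case: ifPn => [t't|]; first exact: (HJ t').2.2.
  by rewrite negbK => /eqP ->; rewrite /rival eqxx.
have J0_gt0 : 0 < `|J0|.
  have P0 : (wendX R l k)`_(k.*2.+1) != 0.
    by apply: coef_wendX_centre_neq0; rewrite /l addn1.
  rewrite normr_gt0 /J0 -enorm_sqr.
  apply: mulf_neq0; first by rewrite expf_neq0 // lt0r_neq0.
  apply: mulf_neq0; last by rewrite expf_neq0 // lt0r_neq0.
  by rewrite mulf_neq0 // pnatr_eq0.
have [d1|d1] := eqVneq d 1%N; last first.
  by move: J0_le; rewrite big_pred0 ?leNgt ?J0_gt0 // => t'; rewrite /rival (negbTE d1) !andbF.
have two_rivals : (#|[pred t' | rival t']| <= 2)%N.
  rewrite -card_bool.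
  pose i0 : 'I_d := cast_ord (esym d1) ord0.
  have all_i0 (i : 'I_d) : i = i0.
    by apply: val_inj => /=; have := ltn_ord i; lia.
  apply: (@leq_card_in _ _ (fun t' => y t' ord0 i0 < y t ord0 i0)).
  move=> t2 t3; rewrite !inE => /andP[_ /andP[_ /eqP h2]] /andP[_ /andP[_ /eqP h3]] h.
  apply: yinj; apply/rowP => i; rewrite (all_i0 i).
  have norm1 (x : 'rV[R]_d) : enorm x = `|x ord0 i0|.
    rewrite /enorm /dotv (bigD1 i0) //= big1 ?addr0 -?expr2 ?sqrtr_sqr // => j.
    by rewrite (all_i0 j) eqxx.
  have /(mulfI (lt0r_neq0 c0)) : c * enorm (y t - y t2) = c * enorm (y t - y t3).
    by rewrite h2 h3.
  rewrite !norm1 !mxE; move: h; case: ltP => h2'; case: ltP => h3' // _.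
    by rewrite !gtr0_norm ?subr_gt0 //; lra.
  by rewrite !ler0_norm ?subr_le0 //; lra.
have BE : B = enorm u ^+ 2 * (c * enorm u) ^+ k.*2.+1 * (wendY R l k)`_(l + k).
  by rewrite /B /n [(c * enorm u) ^+ k.*2.+2]exprS; field; rewrite gt_eqF.
have J0E : `|J0| = 2 * (enorm u ^+ 2 * (c * enorm u) ^+ k.*2.+1 *
    `|(wendX R l k)`_(k.*2.+1)|).
  rewrite /J0 -enorm_sqr normrM (ger0_norm (sqr_ge0 _)) normrM (normrM 2).
  by rewrite (ger0_norm (ler0n _ 2)) normrX (gtr0_norm cu); ring.
have B2 : \sum_(t' | rival t') B <= 2 * B.
  rewrite sumr_const -[B *+ _]mulr_natl ler_wpM2r ?ler_nat //.
  by rewrite BE !mulr_ge0 ?sqr_ge0 ?exprn_ge0 // ltW.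
have := le_trans J0_le B2; rewrite J0E BE ler_pM2l // ler_pM2l; last first.
  by rewrite mulr_gt0 ?exprn_gt0.
have l1 : (1 < l)%N by rewrite /l addn1 addnS.
have kl : (k < l)%N by rewrite /l; lia.
by rewrite leNgt (wendland_centre_dominates R l1 kl).
Unshelve. all: by end_near. Qed.

End GradientsFree.

(** * Minimal norm under finitely many linear constraints *)

Section ConstrainedMinimalNorm.
Variables (R : realType) (d : nat) (Omega : set 'rV[R]_d).
Variables (K : 'rV[R]_d -> 'rV[R]_d -> R) (H : set ('rV[R]_d -> R)).
Variable ip : ('rV[R]_d -> R) -> ('rV[R]_d -> R) -> R.
Hypothesis hH : is_RKHS Omega K H ip.
Variables (n m : nat) (G : 'I_n -> 'rV[R]_d -> R).
Hypothesis HG : forall r, H (G r).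
Variables (Q : 'M[R]_(m, n)) (b : 'cV[R]_m).
Implicit Types (beta : 'cV[R]_n) (v w : 'rV[R]_d -> R).

Definition gram : 'M[R]_n := \matrix_(r, s) ip (G r) (G s).

Definition comb beta : 'rV[R]_d -> R := fun x => \sum_r beta r ord0 * G r x.

Definition moments v : 'cV[R]_n := \col_r ip v (G r).

Definition constrained v : Prop :=
  H v /\ forall r, (Q *m moments v) r ord0 <= b r ord0.

Hypothesis comb_free : forall beta, comb beta = (fun=> 0) -> beta = 0.

Lemma comb_in beta : H (comb beta).
Proof. by apply: (rkhs_sum hH) => r _. Qed.

Lemma comb_ip beta v : H v ->
  ip (comb beta) v = (beta^T *m moments v) ord0 ord0.
Proof.
move=> Hv; rewrite /comb (rkhs_ip_suml hH) // mxE; apply: eq_bigr => r _.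
by rewrite !mxE (rkhs_ip_sym hH).
Qed.

Lemma moments_comb beta : moments (comb beta) = gram *m beta.
Proof.
apply/colP => r; rewrite !mxE (rkhs_ip_suml hH) //; apply: eq_bigr => s _.
by rewrite !mxE mulrC (rkhs_ip_sym hH).
Qed.

Lemma sqnorm_comb beta :
  ip (comb beta) (comb beta) = (beta^T *m gram *m beta) ord0 ord0.
Proof. by rewrite comb_ip ?moments_comb ?mulmxA //; exact: comb_in. Qed.

Lemma gram_unit : gram \in unitmx.
Proof.
rewrite -row_free_unit; apply: inj_row_free => u uA.
apply: trmx_inj; rewrite trmx0; apply: comb_free.
apply: (rkhs_ip_eq0 hH (comb_in _)).
by rewrite sqnorm_comb trmxK uA mul0mx mxE.
Qed.

(** The coefficients are found by inverting the Gram matrix; the remainder is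
    orthogonal to all the G r, so that the Pythagorean identity holds. *)
Lemma projection v : H v -> exists beta, gram *m beta = moments v /\
  ip v v = ip (comb beta) (comb beta) +
    ip (fun x => v x - comb beta x) (fun x => v x - comb beta x).
Proof.
move=> Hv; pose beta := invmx gram *m moments v.
have E : gram *m beta = moments v by rewrite mulmxA mulmxV ?gram_unit // mul1mx.
exists beta; split=> //; rewrite (rkhs_sqnormB hH Hv (comb_in _)).
have -> : ip v (comb beta) = ip (comb beta) (comb beta).
  rewrite (rkhs_ip_sym hH Hv (comb_in _)) comb_ip // comb_ip ?moments_comb ?E //.
  exact: comb_in.
ring.
Qed.

Lemma constrained_comb beta :
  constrained (comb beta) <-> forall r, (Q *m gram *m beta) r ord0 <= b r ord0.
Proof.
rewrite /constrained moments_comb mulmxA; split=> [[]//|h].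
by split=> //; exact: comb_in.
Qed.

Lemma constrained_mid u v : constrained u -> constrained v ->
  constrained (fun x => 2^-1 * u x + 2^-1 * v x).
Proof.
move=> [Hu bu] [Hv bv]; have Hv' := rkhs_scale hH 2^-1 Hv.
split; first exact: (rkhs_lin hH 2^-1 Hu Hv').
move=> r; have -> : moments (fun x => 2^-1 * u x + 2^-1 * v x) =
    2^-1 *: moments u + 2^-1 *: moments v.
  by apply/colP => s; rewrite !mxE (rkhs_ip_lin hH) // (rkhs_ipZl hH).
rewrite mulmxDr -!scalemxAr !mxE; have := bu r; have := bv r; rewrite !mxE; lra.
Qed.

Lemma constrained_closed (u : nat -> 'rV[R]_d -> R) v :
  (forall i, constrained (u i)) -> H v ->
  (forall e, 0 < e -> exists N, forall i, (N <= i)%N ->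
    ip (fun x => u i x - v x) (fun x => u i x - v x) < e) -> constrained v.
Proof.
move=> cu Hv uv; split=> // r.
pose q : 'cV[R]_n := \col_s Q r s.
have qE w : H w -> (Q *m moments w) r ord0 = ip (comb q) w.
  move=> Hw; rewrite comb_ip // !mxE; apply: eq_bigr => s _; by rewrite !mxE.
rewrite qE // leNgt; apply/negP => bv.
pose e := ip (comb q) v - b r ord0; have e0 : 0 < e by rewrite subr_gt0.
pose g := ip (comb q) (comb q); have g0 : 0 <= g := rkhs_ip_ge0 hH (comb_in q).
have g1 : 0 < g + 1 by rewrite ltr_wpDl.
have [|N HN] := uv (e ^+ 2 / (g + 1)); first by rewrite divr_gt0 ?exprn_gt0.
have Hu := (cu N).1; have := HN N (leqnn _); rewrite ltr_pdivlMr //.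
have := rkhs_cauchy_schwarz hH (comb_in q) (rkhs_sub hH Hu Hv).
rewrite (rkhs_ipBr hH Hu Hv (comb_in q)) -/g.
have := (cu N).2 r; rewrite qE //.
have := rkhs_ip_ge0 hH (rkhs_sub hH Hu Hv); set D := ip (fun x => _) _.
rewrite /e in e0 *; nra.
Qed.

(** The midpoint of two distinct minimisers would have a smaller norm. *)
Lemma min_norm_unique u v : constrained u -> constrained v ->
  (forall w, constrained w -> ip u u <= ip w w) -> ip v v <= ip u u -> u = v.
Proof.
move=> cu cv umin vu; have [Hu _] := cu; have [Hv _] := cv.
have mid := umin _ (constrained_mid cu cv).
rewrite (rkhs_sqnorm_mid hH Hu Hv) in mid.
have Huv := rkhs_sub hH Hu Hv.
have D0 := rkhs_ip_ge0 hH Huv.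
have : ip (fun x => u x - v x) (fun x => u x - v x) = 0.
  by apply: le_anti; rewrite D0 andbT (rkhs_sqnormB hH Hu Hv); lra.
move=> /(rkhs_ip_eq0 hH Huv) E; apply/funext => x.
by have := congr1 (fun f => f x) E; move=> /eqP; rewrite subr_eq0 => /eqP.
Qed.

Lemma comb_inj beta beta' : comb beta = comb beta' -> beta = beta'.
Proof.
move=> E; apply/eqP; rewrite -subr_eq0; apply/eqP/comb_free/funext => x.
have -> : comb (beta - beta') x = comb beta x - comb beta' x.
  by rewrite /comb -sumrB; apply: eq_bigr => r _; rewrite !mxE mulrBl.
by rewrite E subrr.
Qed.

(** Since the constraints depend on the moments only, projecting the minimiser
    onto the span of the G r keeps it feasible and does not increase its norm:
    by uniqueness it lies in the span. *)
Theorem min_norm_quadratic_program :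
  (exists beta, forall r, (Q *m gram *m beta) r ord0 <= b r ord0) ->
  exists beta, [/\ constrained (comb beta),
    forall w, constrained w -> ip (comb beta) (comb beta) <= ip w w &
    forall w, constrained w -> ip w w <= ip (comb beta) (comb beta) ->
      w = comb beta].
Proof.
move=> [beta0 /constrained_comb c0].
have [||v cv vmin] := rkhs_min_norm hH (S := constrained) _ _ constrained_mid constrained_closed.
- by exists (comb beta0).
- by move=> u [].
have [Hv bv] := cv; have [beta [E vE]] := projection Hv.
have cb : constrained (comb beta).
  by split; [exact: comb_in|rewrite moments_comb E].
have vb : v = comb beta.
  apply: (min_norm_unique cv cb vmin); rewrite vE lerDl.
  by apply: (rkhs_ip_ge0 hH); exact: (rkhs_sub hH Hv (comb_in _)).
exists beta; rewrite -vb; split=> // w cw wv; apply/esym.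
exact: min_norm_unique.
Qed.

End ConstrainedMinimalNorm.

(** * The collocation problem *)

(** For k = 0 the profile is (1 - c r)^l, whose derivative -c l at 0 does not
    vanish, so that its quotient by r is unbounded. *)
Lemma Psi1_not_cvg (R : realType) (d : nat) (c : R) : 0 < c ->
  ~ cvg (Psi d 0 c 1 r @[r --> 0^'+]).
Proof.
move=> c0; set l := (d./2 + 0 + 1)%N => /cvg_ex[/= L PL].
have l0 : (0 < l)%N by rewrite /l addn1.
pose p : {poly R} := wendX R l 0 \Po (c *: 'X).
have near_p : \forall r \near 0^'+, (p^`()).[r] = r * Psi d 0 c 1 r.
  near=> r.
  have r0 : 0 < r by near: r; exact: nbhs_right_gt.
  have r1 : r < c^-1 by near: r; apply: nbhs_right_lt; rewrite invr_gt0.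
  rewrite [Psi _ _ _ _ _]/= mulrA mulfV ?gt_eqF // mul1r derivE !derive1E.
  apply: near_eq_derive; near=> s.
  have s1 : s < c^-1 by near: s; exact: lt_nbhsl.
  rewrite /p horner_comp hornerZ hornerX -wendland_le1 //.
  by rewrite -(mulfV (lt0r_neq0 c0)) ler_wpM2l ?ltW.
have lim0 : (p^`()).[r] @[r --> 0^'+] --> 0 * L.
  have id0 : r @[r --> 0^'+] --> (0 : R) by apply: cvg_at_right_filter; exact: cvg_id.
  by apply: cvg_trans (cvgM id0 PL); apply: near_eq_cvg; near=> r; rewrite (near near_p r).
have limp : (p^`()).[r] @[r --> 0^'+] --> (p^`()).[0].
  by apply: cvg_at_right_filter; exact: continuous_horner.
have : (p^`()).[0] = 0 * L by apply: cvg_unique limp lim0.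
rewrite mul0r /p deriv_comp derivZ derivX hornerM horner_comp !(hornerZ, hornerX, hornerC).
rewrite mulr0 mulr1 horner_coef0 coef_deriv mulr1n coef1_wendX0 => /eqP.
by rewrite mulf_eq0 oppr_eq0 pnatr_eq0 (gtn_eqF l0) (gt_eqF c0).
Unshelve. all: by end_near. Qed.

Section Instance.
Variables (R : realType) (d k0 k : nat) (Omega : set 'rV[R]_d) (c : R).
Variables (H : set ('rV[R]_d -> R)).
Variable ip : ('rV[R]_d -> R) -> ('rV[R]_d -> R) -> R.
Hypotheses (hH : is_RKHS Omega (@Phi R d k.+1 c) H ip) (oOmega : open Omega).
Hypothesis c0 : 0 < c.
Variables (C : 'I_k0 -> set 'rV[R]_d) (f : 'I_k0 -> 'rV[R]_d -> 'rV[R]_d).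
Variables (b : 'I_k0 -> 'rV[R]_d -> R) (D : collocation R d k0).
Hypotheses (hparts : enumerates_parts D Omega C).
Hypotheses (hpts : collocation_points D Omega C).
Hypothesis hbasis : basis_selection f D.

Local Notation BI := (basis_index f D).
Local Notation DI := (dep_index f D).
Local Notation W := (wendland (d./2 + k.+1 + 1) k).

Lemma npt_in (t : node D) : Omega (npt t).
Proof. by have [_ _ /(_ t)[]] := hpts. Qed.

(** Points with different theta lie in different, hence disjoint, parts. *)
Lemma npt_inj : injective (@npt R d k0 D).
Proof.
have [pinj _ ppart] := hpts; move=> t1 t2 E.
have [_ [in1 out1]] := ppart t1; have [_ [in2 out2]] := ppart t2.
have sets : nset t1 = nset t2.
  apply/setP => i; apply/idP/idP => it; apply: contraT => nit.
    by have := out2 i nit; rewrite -E => /(_ (in1 i it)).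
  by have := out1 i nit; rewrite E => /(_ (in2 i it)).
have tags : tag t1 = tag t2 := hparts.1 _ _ sets.
clear in1 out1 in2 out2 sets.
case: t1 t2 E tags => [th1 l1] [th2 l2] /= E th12; subst th2.
by congr existT; apply: pinj.
Qed.

Lemma lamE (t : node D) i v : lam f t i v = dotv (grad v (npt t)) (fvec f t i).
Proof. by []. Qed.

Let lamG (t : node D) (i : nat) : 'rV[R]_d -> R := restr0 Omega
  (fun x => c ^+ 2 * W (c * enorm (x - npt t)) * dotv (x - npt t) (fvec f t i)).

Let lamG_in t i : H (lamG t i).
Proof. by have [] := wendland_gradient_riesz hH oOmega c0 (fvec f t i) (npt_in t). Qed.

Let lamG_ip t i v : H v -> lam f t i v = ip v (lamG t i).
Proof. by have [_] := wendland_gradient_riesz hH oOmega c0 (fvec f t i) (npt_in t); apply. Qed.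

Lemma lamKE (i : BI) x : lamK (Phi k.+1 c) i x =
  c ^+ 2 * W (c * enorm (x - npt (tag i))) *
    dotv (x - npt (tag i)) (fvec f (tag i) (tagged i)).
Proof. exact: dotv_grad_Phi. Qed.

Let G (r : 'I_#|BI|) := lamG (tag (enum_val r)) (tagged (enum_val r)).

Let HG r : H (G r). Proof. exact: lamG_in. Qed.

Let GE r : G r = restr0 Omega (lamK (Phi k.+1 c) (enum_val r)).
Proof. by congr (restr0 Omega _); apply/funext => x; rewrite lamKE. Qed.

Lemma lam_restr0 (t : node D) i v : lam f t i (restr0 Omega v) = lam f t i v.
Proof.
rewrite !lamE; congr (dotv _ _); apply/rowP => j; rewrite !mxE.
apply: near_eq_derive; near=> x; rewrite /restr0 patchE mem_set //.
by near: x; apply: open_nbhs_nbhs; split=> //; exact: npt_in.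
Unshelve. all: by end_near. Qed.

Lemma matAE : matA f D (Phi k.+1 c) = gram ip G.
Proof.
by apply/matrixP => r s; rewrite !mxE; cbv zeta; rewrite -lam_restr0 -GE lamG_ip.
Qed.

Lemma vsolE beta : vsol (Phi k.+1 c) Omega beta = comb G beta.
Proof.
apply/funext => x; rewrite /vsol /comb /restr0 patchE.
rewrite (reindex (@enum_val BI xpredT)) /=; last exact/onW_bij/enum_val_bij.
case: ifPn => xO.
  by apply: eq_bigr => r _; rewrite enum_valK GE /restr0 patchE xO.
by rewrite big1 // => r _; rewrite GE /restr0 patchE (negbTE xO) mulr0.
Qed.

(** Grouping the coefficients by node reduces to the gradients of the kernel at
    distinct centres; within a node the selected vectors f_p form a basis. *)
Lemma comb_lam_free beta : comb G beta = (fun=> 0) -> beta = 0.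
Proof.
move=> E0.
pose a (t : node D) (i : 'I_(rank f t)) := beta (enum_rank (Tagged _ i : BI)) ord0.
pose w t := \sum_i a t i *: fvec f t i.
have w0 : forall t, w t = 0.
  apply: (kernel_gradients_free c0 (k := k) oOmega npt_in npt_inj) => x Ox.
  have : vsol (Phi k.+1 c) Omega beta x = 0 by rewrite vsolE E0.
  rewrite /vsol /restr0 patchE mem_set //.
  have -> : \sum_(i : BI) beta (enum_rank i) ord0 * lamK (Phi k.+1 c) i x =
      c ^+ 2 * \sum_t W (c * enorm (x - npt t)) * dotv (x - npt t) (w t).
    rewrite mulr_sumr.
    under eq_bigr do rewrite lamKE.
    under [RHS]eq_bigr do rewrite dotv_sumr !mulr_sumr.
    rewrite sig_big_dep /=.
    apply: eq_bigr => -[t i] _ /=; rewrite /a; ring.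
  by move=> /eqP; rewrite mulf_eq0 expf_eq0 /= gt_eqF // => /eqP.
apply/colP => r; rewrite mxE -(enum_valK r); case: (enum_val r) => t i.
have [_ /basis_free Xfree _] := hbasis t.
have sizeX : size [seq fvec f t i | i <- iota 0 (rank f t)] == rank f t.
  by rewrite size_map size_iota.
have /freeP free_t : free (Tuple sizeX) by [].
apply: (free_t (a t)); rewrite -[RHS](w0 t); apply: eq_bigr => j _ /=.
by rewrite (nth_map 0%N) ?size_iota // nth_iota.
Qed.

Lemma lam_dep (t : node D) s v : (s < #|nset t|)%N ->
  lam f t s v = \sum_(i < rank f t) ncoef t s i * lam f t i v.
Proof.
move=> st; have [_ _ /(_ s st) E] := hbasis t.
by rewrite lamE E dotv_sumr.
Qed.

Lemma rank_le (t : node D) : (rank f t <= #|nset t|)%N.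
Proof. by rewrite (leq_trans (dim_span _)) // size_image. Qed.

Lemma matQ_moments v : H v -> forall r : 'I_(#|BI| + #|DI|),
  (matQ f D *m moments ip G v) r ord0 =
  match fintype.split r with
  | inl s => let i : BI := enum_val s in lam f (tag i) (tagged i) v
  | inr s => let u : DI := enum_val s in
             lam f (tag u) (tagged u + rank f (tag u)) v
  end.
Proof.
move=> Hv r; rewrite /matQ mul_col_mx mul1mx.
case: split_ordP => s ->; first by rewrite col_mxEu mxE lamG_ip.
rewrite col_mxEd !mxE; set u : DI := enum_val s.
rewrite lam_dep; last by have := ltn_ord (tagged u); rewrite ltn_subRL addnC.
transitivity (\sum_(i : BI) if tag u == tag i
    then ncoef (tag u) (tagged u + rank f (tag u)) (tagged i) * lam f (tag i) (tagged i) v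
    else 0).
  rewrite [RHS](reindex (@enum_val BI xpredT)) /=; last exact/onW_bij/enum_val_bij.
  apply: eq_bigr => r' _; rewrite !mxE lamG_ip //; cbv zeta; rewrite -/u.
  by case: ifP => _; rewrite ?mul0r.
rewrite -(@sig_big_dep _ _ +%R _ (fun t => 'I_(rank f t)) xpredT
  (fun _ => xpredT) (fun t (i : 'I_(rank f t)) => if tag u == t then
     ncoef (tag u) (tagged u + rank f (tag u)) i * lam f t i v else 0)) /=.
rewrite (bigD1 (tag u)) //= [X in _ + X]big1 ?addr0 => [|t tu].
  by apply: eq_bigr => i _; rewrite eqxx.
by apply: big1 => i _; rewrite eq_sym (negbTE tu).
Qed.

Lemma M_feasibleP v :
  M_feasible f b D H v <-> constrained H ip G (matQ f D) (vecb f b D) v.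
Proof.
split=> [[Hv lv]|[Hv Qv]]; split=> //.
  move=> r; rewrite matQ_moments // /vecb.
  case: split_ordP => s ->; rewrite ?col_mxEu ?col_mxEd mxE; apply: lv.
    by apply: leq_trans (rank_le _); exact: ltn_ord.
  by have := ltn_ord (tagged (enum_val s)); rewrite ltn_subRL addnC.
move=> t i it; have [ir|ri] := ltnP i (rank f t).
  pose j : BI := Tagged _ (Ordinal ir).
  have := Qv (lshift _ (enum_rank j)); rewrite matQ_moments // /vecb col_mxEu mxE.
  by rewrite (unsplitK (inl _)) /= !enum_rankK.
have ir : (i - rank f t < #|nset t| - rank f t)%N by rewrite ltn_sub2r // (leq_ltn_trans ri).
pose j : DI := Tagged _ (Ordinal ir).
have := Qv (rshift _ (enum_rank j)); rewrite matQ_moments // /vecb col_mxEd mxE.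
by rewrite (unsplitK (inr _)) /= !enum_rankK /= subnK.
Qed.

Lemma hnorm_le u v : H u -> H v -> (hnorm ip u <= hnorm ip v) = (ip u u <= ip v v).
Proof. by move=> Hu Hv; rewrite /hnorm ler_sqrt // (rkhs_ip_ge0 hH). Qed.

Lemma min_norm_representation :
  (exists beta : 'cV[R]_#|BI|, QP_feasible b (Phi k.+1 c) beta) ->
  exists beta : 'cV[R]_#|BI|,
    (forall beta', QP_minimiser b (Phi k.+1 c) beta' <-> beta' = beta) /\
    (forall w, M_minimiser f b D H ip w <-> w = vsol (Phi k.+1 c) Omega beta).
Proof.
have QPE beta : QP_feasible b (Phi k.+1 c) beta <->
    constrained H ip G (matQ f D) (vecb f b D) (comb G beta).
  by rewrite (constrained_comb hH HG) /QP_feasible matAE.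
have objE beta : QP_objective (Phi k.+1 c) beta = ip (comb G beta) (comb G beta).
  by rewrite (sqnorm_comb hH HG) /QP_objective matAE.
move=> [beta0 /QPE/(constrained_comb hH HG) f0].
have [|beta [cb bmin buniq]] := min_norm_quadratic_program hH HG comb_lam_free
  (Q := matQ f D) (b := vecb f b D); first by exists beta0.
exists beta; split=> [beta'|w]; rewrite ?vsolE; split.
- move=> [/QPE cb' min']; apply: (comb_inj comb_lam_free); apply: buniq => //.
  by rewrite -!objE; apply: min'; exact/QPE.
- move=> ->; split; first exact/QPE.
  by move=> gamma /QPE cg; rewrite !objE; exact: bmin.
- move=> [/M_feasibleP cw wmin]; apply: buniq => //.
  by rewrite -hnorm_le; [apply: wmin; exact/M_feasibleP|exact: cw.1|exact: cb.1].
- move=> ->; split; first exact/M_feasibleP.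
  move=> u /M_feasibleP cu; rewrite hnorm_le; [exact: bmin|exact: cb.1|exact: cu.1].
Qed.

End Instance.

Theorem theorem3p4 (R : realType) (d k0 : nat) (hd : (0 < d)%N)
  (Omega : set 'rV[R]_d) (hOmega : lipschitz_domain Omega)
  (C : 'I_k0 -> set 'rV[R]_d) (f : 'I_k0 -> 'rV[R]_d -> 'rV[R]_d)
  (hsys : switched_system Omega C f)
  (traj : R -> (R -> 'rV[R]_d) -> (R -> 'I_k0) -> Prop)
  (hslide : no_sliding_modes C f traj)
  (c : R) (hc : 0 < c) (k : nat)
  (hk1 : cvg (Psi d k c 1 r @[r --> 0^'+]))
  (hk2 : cvg (Psi d k c 2 r @[r --> 0^'+]))
  (H : set ('rV[R]_d -> R)) (ip : ('rV[R]_d -> R) -> ('rV[R]_d -> R) -> R)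
  (hH : is_RKHS Omega (Phi k c) H ip)
  (b : 'I_k0 -> 'rV[R]_d -> R)
  (hb0 : forall p, b p 0 = 0)
  (hb : forall p x, C p x -> x != 0 -> b p x < 0)
  (D : collocation R d k0)
  (hparts : enumerates_parts D Omega C)
  (hpts : collocation_points D Omega C)
  (hbasis : basis_selection f D) :
  (exists beta : 'cV[R]_#|basis_index f D|, QP_feasible b (Phi k c) beta) ->
  exists beta : 'cV[R]_#|basis_index f D|,
    (forall beta', QP_minimiser b (Phi k c) beta' <-> beta' = beta) /\
    (forall w, M_minimiser f b D H ip w <-> w = vsol (Phi k c) Omega beta).
Proof.
have oOmega : open Omega by have [] := hOmega.
case: k hk1 {hk2} hH => [/(Psi1_not_cvg hc)//|k' _ hH'].
exact: (min_norm_representation hH' oOmega hc hparts hpts hbasis).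
Qed.
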